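(* Let $A\subseteq\mathbb{R}^n$, $a\in\mathbb{R}^n$, $\nu\in\mathbf{S}^{n-1}$ (a unit vector), $0<r<\infty$, and suppose $\mathbf{U}(a+r\nu,r)\cap A=\varnothing$, where $\mathbf{U}(a+r\nu,r)$ is the open ball of centre $a+r\nu$ and radius $r$. Then the following three statements hold. (1) If $A$ is a submanifold of class $2$ of $\mathbb{R}^n$ and $a\in A$, then $\mathbf{b}_A(a)(v,v)\bullet\nu\le r^{-1}|v|^2$ whenever $v\in\mathrm{Tan}(A,a)$. (2) If $A$ is pointwise differentiable of order $2$ at $a$, then $\mathrm{pt\,D}^2A(a,\mathrm{Tan}(A,a))(v,v)\bullet\nu\le r^{-1}|v|^2$ whenever $v\in\mathrm{Tan}(A,a)$. (3) If $A$ is approximately differentiable of order $2$ at $a$, then $\mathrm{ap\,D}^2A(a)(v,v)\bullet\nu\le r^{-1}|v|^2$ whenever $v\in\mathrm{ap\,Tan}(A,a)$.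
   Context: Notation. $\bullet$ is the inner product. $\mathscr{H}^m$ is the $m$ dimensional Hausdorff measure on $\mathbb{R}^n$, regarded as an outer measure; $\boldsymbol{\alpha}(m)$ is the Lebesgue measure of the unit ball of $\mathbb{R}^m$; $\mathbf{B}(a,r)$ is the closed ball. $\mathbf{G}(n,m)$ is the set of $m$ dimensional linear subspaces of $\mathbb{R}^n$; $T_\natural$ is the orthogonal projection onto $T$, $T^\perp$ the orthogonal complement, $T^\perp_\natural$ the projection onto $T^\perp$. $\boldsymbol{\delta}_B(x)=\inf\{|x-b|:b\in B\}$; $\mathrm{gr}(f)=\{\chi+f(\chi):\chi\in T\}$ for $f:T\to T^\perp$; $\mathbf{C}(T,a,s,t)=\{x:|T_\natural(x-a)|<s,\ |T^\perp_\natural(x-a)|<t\}$. Tangent cones. $\mathrm{Tan}^*(A,a)=\{v:\liminf_{r\to0+}r^{-1}\boldsymbol{\delta}_A(a+rv)=0\}$, $\mathrm{Tan}_*(A,a)=\{v:\lim_{r\to0+}r^{-1}\boldsymbol{\delta}_A(a+rv)=0\}$; if they coincide, the common set is $\mathrm{Tan}(A,a)$. For a submanifold $M$ this is the usual tangent space; $\mathrm{Nor}(M,a)$ is its orthogonal complement. Second fundamental form. If $M$ is an $m$ dimensional submanifold of class $2$ of $\mathbb{R}^n$ and $a\in M$, $\mathbf{b}_M(a):\mathrm{Tan}(M,a)\times\mathrm{Tan}(M,a)\to\mathrm{Nor}(M,a)$ is the unique symmetric bilinear function with $\mathbf{b}_M(a)(u,v)\bullet\nu(a)=-\mathrm{D}\nu(a)(u)\bullet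 v$ for all $u,v\in\mathrm{Tan}(M,a)$ whenever $\nu:M\to\mathbb{R}^n$ is of class $1$ relative to $M$ with $\nu(x)\in\mathrm{Nor}(M,x)$ for every $x\in M$. Pointwise differentiability. $A$ is pointwise differentiable of order $2$ at $a$ if there is a submanifold $M\subseteq\mathbb{R}^n$ of class $2$ with $a\in M$, $\lim_{r\to0+}r^{-1}\sup\{|\boldsymbol{\delta}_M(x)-\boldsymbol{\delta}_A(x)|:x\in\mathbf{B}(a,r)\}=0$ and $\lim_{r\to0+}r^{-2}\sup\{\boldsymbol{\delta}_M(x):x\in\mathbf{B}(a,r)\cap A\}=0$. In this case $S=\mathrm{Tan}(A,a)$ is a linear subspace and $\mathrm{pt\,D}^2A(a,S)=\mathrm{D}^2(f\circ S_\natural)(a)$, where $f:S\to S^\perp$ is any function of class $2$ such that $a\in\mathrm{gr}(f)$ and the two preceding limit conditions hold with $M=\mathrm{gr}(f)$ (such $f$ exists and the value does not depend on its choice). Approximate differentiability. Let $A_1=\{x-a:x\in A\}$. For an integer $k\ge1$, $A$ is approximately differentiable of order $k$ at $a$ if there exist an integer $1\le m\le n$, $T\in\mathbf{G}(n,m)$ and a polynomial function $P:T\to T^\perp$ of degree at most $k$ with $P(0)=0$, $\mathrm{D}P(0)=0$ such that: (i) for every $\epsilon>0$ there exist $\rho>0$, $\eta>0$ with $\mathscr{H}^m(\mathbf{C}(T,z,\epsilon r,\epsilon r)\cap A_1)\ge\eta r^m$ for all $0\le r\le\rho$ and $z\in T\cap\mathbf{B}(0,r)$; (ii) for every $\epsilon>0$,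 $\lim_{r\to0+}\frac{\mathscr{H}^m(A_1\cap\mathbf{B}(0,r)\cap\{z:\boldsymbol{\delta}_{\mathrm{gr}(P)}(z)>\epsilon r^k\})}{\boldsymbol{\alpha}(m)r^m}=0$. Here $m,T$ are uniquely determined by $A,a$, and $P$ by $A,a,k$. $\mathrm{ap\,Tan}(A,a)=T$. If $A$ is approximately differentiable of order $2$ at $a$, then $\mathrm{ap\,D}^2A(a)=\mathrm{D}^2(P\circ T_\natural)(0)$, where $T=\mathrm{ap\,Tan}(A,a)$ and $P:T\to T^\perp$ is the unique polynomial function of degree at most $2$ with $P(0)=0$, $\mathrm{D}P(0)=0$ such that conditions (i) and (ii) hold with $m=\dim T$ and $k=2$. *)

(* Defs.v *)
From HB Require Import structures.
From mathcomp Require Import all_boot all_order all_algebra.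
From mathcomp Require Import all_classical all_reals all_analysis.

Set Implicit Arguments.
Unset Strict Implicit.
Unset Printing Implicit Defensive.

Import Order.TTheory GRing.Theory Num.Theory.
Import numFieldNormedType.Exports.

Local Open Scope classical_set_scope.
Local Open Scope ring_scope.

(* R^n is 'rV[R]_n.  The norm `|x| of the library on that type is the maximum
   norm; it is used only through the topology and the differentiability
   notions that it induces.  All metric quantities below are Euclidean. *)

Section euclidean.
Context {R : realType} {n : nat}.
Implicit Types (x u v : 'rV[R]_n) (T : {vspace 'rV[R]_n}) (B : set 'rV[R]_n).

Definition dot u v : R := \sum_i u 0 i * v 0 i.

Definition enorm u : R := Num.sqrt (dot u u).

Definition eoball x (r : R) : set 'rV[R]_n := [set y | enorm (y - x) < r].

Definition ecball x (r : R) : set 'rV[R]_n := [set y | enorm (y - x) <= r].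

Definition basis_dot T v : 'rV[R]_(\dim T) := \row_i dot (vbasis T)`_i v.

Definition orthv T : {vspace 'rV[R]_n} := lker (linfun (basis_dot T)).

Definition oproj T : 'rV[R]_n -> 'rV[R]_n := daddv_pi T (orthv T).

(* Extended real-valued: the distance to the empty set is +oo. *)
Definition edist B x : \bar R := ereal_inf [set (enorm (x - b))%:E | b in B].

Definition cylinder T x (s t : R) : set 'rV[R]_n :=
  [set y | enorm (oproj T (y - x)) < s /\ enorm (oproj (orthv T) (y - x)) < t].

(* A function T -> T^perp is encoded by a total function f on R^n, of which
   only the values on T are used. *)
Definition maps_to_orth T (f : 'rV[R]_n -> 'rV[R]_n) :=
  forall x, x \in T -> f x \in orthv T.

Definition graph T (f : 'rV[R]_n -> 'rV[R]_n) : set 'rV[R]_n :=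
  [set x + f x | x in [set` T]].

End euclidean.

Section orth_theory.
Context {R : realType} {n : nat}.
Implicit Types (x u v w : 'rV[R]_n) (T : {vspace 'rV[R]_n}).

Lemma dotC u v : dot u v = dot v u.
Proof. by apply: eq_bigr => i _; rewrite mulrC. Qed.

Lemma dotDr u v w : dot u (v + w) = dot u v + dot u w.
Proof. by rewrite /dot -big_split; apply: eq_bigr => i _; rewrite mxE mulrDr. Qed.

Lemma dotZr u c v : dot u (c *: v) = c * dot u v.
Proof. by rewrite /dot mulr_sumr; apply: eq_bigr => i _; rewrite mxE mulrCA. Qed.

Lemma dot_eq0 u : (dot u u == 0) = (u == 0).
Proof.
apply/eqP/eqP => [|->]; last by rewrite /dot big1 // => i _; rewrite mxE mul0r.
move=> /eqP; rewrite psumr_eq0 => [/allP h|i _]; last exact: sqr_ge0.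
apply/rowP => i; rewrite mxE; apply/eqP.
by have := h i (mem_index_enum _); rewrite mulf_eq0 orbb.
Qed.

Lemma basis_dot_linear T : linear (basis_dot T).
Proof. by move=> c u v; apply/rowP => i; rewrite !mxE dotDr dotZr. Qed.

HB.instance Definition _ T :=
  GRing.isLinear.Build R 'rV[R]_n 'rV[R]_(\dim T) _ (basis_dot T)
    (@basis_dot_linear T).

Lemma memv_orthv T v :
  v \in orthv T <-> (forall u, u \in T -> dot u v = 0).
Proof.
rewrite memv_ker lfunE /=; split=> [/eqP h u uT|h]; last first.
  apply/eqP/rowP => i; rewrite !mxE; apply: h.
  by apply: vbasis_mem; rewrite mem_nth // size_tuple.
rewrite (coord_vbasis uT) dotC.
elim/big_ind: _ => [|x y hx hy|i _].
- by rewrite -(scale0r 0) dotZr mul0r.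
- by rewrite dotDr hx hy addr0.
- by have /rowP/(_ i) := h; rewrite !mxE dotZr dotC => ->; rewrite mulr0.
Qed.

Lemma capv_orthv T : (T :&: orthv T = 0)%VS.
Proof.
apply/eqP; rewrite -subv0; apply/subvP => v.
rewrite memv_cap memv0 => /andP[vT /memv_orthv /(_ _ vT) /eqP].
by rewrite dot_eq0.
Qed.

Lemma addv_orthv T : (T + orthv T = fullv)%VS.
Proof.
apply/eqP; rewrite eqEdim subvf /= (dimv_disjoint_sum (capv_orthv T)).
have := limg_ker_dim (linfun (basis_dot T)) fullv.
rewrite capfv -/(orthv T) => <-.
rewrite addnC leq_add2r.
by rewrite (leq_trans (dimvS (subvf _))) // dimvf /dim /= mul1n.
Qed.

Lemma oprojP T x : oproj T x \in T /\ x - oproj T x \in orthv T.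
Proof.
split; first exact: memv_pi.
have xTT : x \in (T + orthv T)%VS by rewrite addv_orthv memvf.
by rewrite -{1}(daddv_pi_add (capv_orthv T) xTT) addrC addKr memv_pi.
Qed.

End orth_theory.

Section differential.
Context {R : realType} {n : nat}.
Implicit Types (f F : 'rV[R]_n -> 'rV[R]_n) (U : set 'rV[R]_n).

(* Meaningful for open U.  In finite dimension, 'd f is of class k as a map into
   the linear maps iff each x |-> 'd f x v is of class k. *)
Fixpoint class_on (k : nat) U f : Prop :=
  match k with
  | 0 => forall x, U x -> {for x, continuous f}
  | k'.+1 => (forall x, U x -> differentiable f x) /\
             (forall v, class_on k' U (fun x => 'd f x v))
  end.

Definition D2 F (a u v : 'rV[R]_n) : 'rV[R]_n := 'd (fun x => 'd F x v) a u.

(* Locally, a diffeomorphism phi of class k (with inverse psi) between open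
   sets straightens M to an m dimensional linear subspace Z. *)
Definition submanifold (k m : nat) (M : set 'rV[R]_n) : Prop :=
  forall b, M b -> exists U phi psi (Z : {vspace 'rV[R]_n}),
    [/\ open U /\ U b,
        class_on k U phi,
        open (phi @` U) /\ class_on k (phi @` U) psi,
        (forall x, U x -> psi (phi x) = x) &
        \dim Z = m /\ phi @` (M `&` U) = [set` Z] `&` phi @` U].

End differential.

Section tangent.
Context {R : realType} {n : nat}.
Implicit Types (A M : set 'rV[R]_n) (a : 'rV[R]_n).

Definition Tan_upper A a : set 'rV[R]_n :=
  [set v | limf_einf (fun r : R => r^-1%:E * edist A (a + r *: v))%E 0^'+ = 0%E].

Definition Tan_lower A a : set 'rV[R]_n :=
  [set v | (fun r : R => r^-1%:E * edist A (a + r *: v))%E @ 0^'+ --> 0%E].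

(* The common value of the two cones when they coincide, set0 otherwise. *)
Definition Tan A a : set 'rV[R]_n :=
  [set v | Tan_upper A a = Tan_lower A a /\ Tan_upper A a v].

Definition Nor A a : set 'rV[R]_n :=
  [set w | forall v, Tan A a v -> dot w v = 0].

(* A map of class 1 relative to M is the restriction to M of a map g of class 1
   on an open set containing M, and its derivative at a in a direction u of
   Tan(M, a) is 'd g a u.  Only the values of b on Tan(M, a) matter. *)
Definition second_fundamental_form M a
    (b : 'rV[R]_n -> 'rV[R]_n -> 'rV[R]_n) : Prop :=
  [/\ forall u v, Tan M a u -> Tan M a v -> Nor M a (b u v),
      forall u v, Tan M a u -> Tan M a v -> b u v = b v u,
      forall c u1 u2 v, Tan M a u1 -> Tan M a u2 -> Tan M a v ->
        b (c *: u1 + u2) v = c *: b u1 v + b u2 v &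
      forall U g, open U -> M `<=` U -> class_on 1 U g ->
        (forall x, M x -> Nor M x (g x)) ->
        forall u v, Tan M a u -> Tan M a v ->
          dot (b u v) (g a) = - dot ('d g a u) v].

End tangent.

Section pointwise.
Context {R : realType} {n : nat}.
Implicit Types (A M : set 'rV[R]_n) (a : 'rV[R]_n) (S : {vspace 'rV[R]_n}).

Definition pt_approx2 A a M : Prop :=
  (fun r : R => r^-1%:E *
     ereal_sup [set `|edist M x - edist A x| | x in ecball a r])%E
    @ 0^'+ --> 0%E /\
  (fun r : R => (r ^- 2)%:E *
     ereal_sup [set edist M x | x in ecball a r `&` A])%E
    @ 0^'+ --> 0%E.

Definition pt_differentiable2 A a : Prop :=
  exists m M, [/\ submanifold 2 m M, M a & pt_approx2 A a M].

(* D is the second order differential pt D^2 A(a, S).  As S is a finite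
   dimensional normed space, f : S -> S^perp is of class 2 iff its composition
   with the projection onto S is. *)
Definition is_ptD2 A a S (D : 'rV[R]_n -> 'rV[R]_n -> 'rV[R]_n) : Prop :=
  exists f, [/\ maps_to_orth S f, class_on 2 setT (f \o oproj S),
    graph S f a, pt_approx2 A a (graph S f) & D = D2 (f \o oproj S) a].

End pointwise.

Section hausdorff.
Context {R : realType}.

(* Lebesgue outer measure of R^m: infimum of the total volume of countable
   covers by closed boxes; a cover is indexed by a subset D of nat. *)
Definition lebesgue_outer {m : nat} (E : set 'rV[R]_m) : \bar R :=
  ereal_inf [set V | exists (D : set nat) (p q : nat -> 'rV[R]_m),
    [/\ forall j i, p j 0 i <= q j 0 i,
        E `<=` \bigcup_(j in D) [set x | forall i, p j 0 i <= x 0 i <= q j 0 i] &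
        V = \esum_(j in D) (\prod_i (q j 0 i - p j 0 i))%:E]].

Definition alpha (m : nat) : R :=
  fine (lebesgue_outer (ecball (0 : 'rV[R]_m) 1)).

Context {n : nat}.
Implicit Types B : set 'rV[R]_n.

(* The 0 makes the diameter of the empty set 0. *)
Definition ediam B : \bar R :=
  ereal_sup [set d | d = 0%E \/ exists x y, [/\ B x, B y & d = (enorm (x - y))%:E]].

Definition hausdorff_pre (m : nat) (d : R) B : \bar R :=
  ereal_inf [set V | exists (D : set nat) (G : nat -> set 'rV[R]_n),
    [/\ B `<=` \bigcup_(j in D) G j,
        forall j, D j -> (ediam (G j) <= d%:E)%E &
        V = \esum_(j in D) ((alpha m / 2 ^+ m)%:E * ediam (G j) ^+ m)%E]].

Definition hausdorff (m : nat) B : \bar R :=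
  ereal_sup [set hausdorff_pre m d B | d in [set d | 0 < d]].

End hausdorff.

Section approximate.
Context {R : realType} {n : nat}.
Implicit Types (A : set 'rV[R]_n) (a : 'rV[R]_n) (T : {vspace 'rV[R]_n}).

(* The sum runs over the multi-indices of length at most k. *)
Definition poly_on (k : nat) T (P : 'rV[R]_n -> 'rV[R]_n) : Prop :=
  exists c : {ffun 'I_n -> 'I_k.+1} -> 'rV[R]_n, forall x, x \in T ->
    P x = \sum_(al : {ffun 'I_n -> 'I_k.+1} | (\sum_i al i <= k)%N)
            (\prod_i x 0 i ^+ al i) *: c al.

Definition ap_approx (k m : nat) A a T (P : 'rV[R]_n -> 'rV[R]_n) : Prop :=
  let A1 := [set x - a | x in A] in
  [/\ [/\ (1 <= m <= n)%N & \dim T = m],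
      [/\ maps_to_orth T P, poly_on k T P, P 0 = 0 &
          forall v, 'd (P \o oproj T) 0 v = 0],
      forall eps : R, 0 < eps -> exists rho eta, [/\ 0 < rho, 0 < eta &
        forall r z, 0 <= r <= rho -> z \in T -> ecball 0 r z ->
          ((eta * r ^+ m)%:E <=
             hausdorff m (cylinder T z (eps * r) (eps * r) `&` A1))%E] &
      forall eps : R, 0 < eps ->
        (fun r : R => hausdorff m (A1 `&` ecball 0 r `&`
             [set z | (eps * r ^+ k)%:E < edist (graph T P) z])
           * ((alpha m * r ^+ m)^-1)%:E)%E
          @ 0^'+ --> 0%E].

Definition ap_differentiable (k : nat) A a : Prop :=
  (1 <= k)%N /\ exists m T P, ap_approx k m A a T P.

Definition is_apTan A a T : Prop :=
  exists k m P, (1 <= k)%N /\ ap_approx k m A a T P.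

Definition is_apD2 A a (D : 'rV[R]_n -> 'rV[R]_n -> 'rV[R]_n) : Prop :=
  exists T P, [/\ is_apTan A a T, ap_approx 2 (\dim T) A a T P &
                  D = D2 (P \o oproj T) 0].

End approximate.

(* Main.v *)
(* If the open ball U(a + r nu, r) misses A, then every y in A satisfies
   2 r (y - a).nu <= |y - a|^2.  Test this on points y = a + t v + o(t) of A.
   To first order it gives v.nu = 0 for all tangent directions v, so the
   t-linear term drops out; to second order, when y lies within o(t^2) of the
   graph of f, the left-hand side is r t^2 D^2 f(v, v).nu + o(t^2) and the
   right-hand side is t^2 |v|^2 + o(t^2).

   For a submanifold A with a chart phi taking A into a subspace Z, let w be
   the covector nu o D phi(a)^-1.  It annihilates Z, so w.phi is constant on A,
   and its expansion at a gives - w.D^2 phi(a)(v, v) <= |v|^2 / r.  The normal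
   field chi(x) (D phi(x))^T w, with a C^1 cutoff chi, extends nu and identifies
   the left-hand side with b(v, v).nu.

   In the approximate case the points y come from comparing the lower density
   condition (i) with the decay condition (ii).  Applied to two different
   approximations, the same comparison shows that the approximate tangent space
   is unique. *)

Require Import Defs.
From HB Require Import structures.
From mathcomp Require Import all_boot all_order all_algebra.
From mathcomp Require Import all_classical all_reals all_analysis.
From mathcomp Require Import ring lra.

Set Implicit Arguments.
Unset Strict Implicit.
Unset Printing Implicit Defensive.

Import Order.TTheory GRing.Theory Num.Theory.
Import numFieldNormedType.Exports.

Local Open Scope classical_set_scope.
Local Open Scope ring_scope.

(** * Euclidean geometry and Taylor expansion *)

Section euclid.
Context {R : realType} {n : nat}.
Implicit Types u v w : 'rV[R]_n.

Lemma dotDl u v w : dot (u + v) w = dot u w + dot v w.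
Proof. by rewrite dotC dotDr ![dot w _]dotC. Qed.

Lemma dotZl c u v : dot (c *: u) v = c * dot u v.
Proof. by rewrite dotC dotZr dotC. Qed.

Lemma dotNr u v : dot u (- v) = - dot u v.
Proof. by rewrite -scaleN1r dotZr mulN1r. Qed.

Lemma dotNl u v : dot (- u) v = - dot u v.
Proof. by rewrite dotC dotNr dotC. Qed.

Lemma dotBr u v w : dot u (v - w) = dot u v - dot u w.
Proof. by rewrite dotDr dotNr. Qed.

Lemma dotBl u v w : dot (u - v) w = dot u w - dot v w.
Proof. by rewrite dotDl dotNl. Qed.

Lemma dot0r u : dot u 0 = 0.
Proof. by rewrite -(scale0r 0) dotZr mul0r. Qed.

Lemma dot_ge0 u : 0 <= dot u u.
Proof. by apply: sumr_ge0 => i _; exact: sqr_ge0. Qed.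

Lemma enorm_ge0 u : 0 <= enorm u.
Proof. exact: sqrtr_ge0. Qed.

Lemma sqr_enorm u : enorm u ^+ 2 = dot u u.
Proof. by rewrite sqr_sqrtr ?dot_ge0. Qed.

Lemma enorm_eq0 u : (enorm u == 0) = (u == 0).
Proof. by rewrite -sqrf_eq0 sqr_enorm dot_eq0. Qed.

Lemma enorm0 : enorm (0 : 'rV[R]_n) = 0.
Proof. by apply/eqP; rewrite enorm_eq0. Qed.

Lemma enormZ c u : enorm (c *: u) = `|c| * enorm u.
Proof. by rewrite /enorm dotZl dotZr mulrA -expr2 sqrtrM ?sqr_ge0 ?sqrtr_sqr. Qed.

Lemma enormN u : enorm (- u) = enorm u.
Proof. by rewrite -scaleN1r enormZ normrN1 mul1r. Qed.

Lemma enorm_distC u v : enorm (u - v) = enorm (v - u).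
Proof. by rewrite -enormN opprB. Qed.

(** Expanding the square of [enorm v *: u - enorm u *: v] gives [enorm u * enorm v - dot u v] times
    a positive factor. *)
Lemma cauchy_schwarz u v : dot u v <= enorm u * enorm v.
Proof.
have [->|u0] := eqVneq u 0; first by rewrite dotC dot0r enorm0 mul0r.
have [->|v0] := eqVneq v 0; first by rewrite dot0r enorm0 mulr0.
have pu : 0 < enorm u by rewrite lt_def enorm_eq0 u0 enorm_ge0.
have pv : 0 < enorm v by rewrite lt_def enorm_eq0 v0 enorm_ge0.
have := dot_ge0 (enorm v *: u - enorm u *: v).
rewrite dotBl !dotBr !(dotZl, dotZr) -!sqr_enorm [dot v u]dotC => H.
have : 0 <= 2 * (enorm u * enorm v) * (enorm u * enorm v - dot u v) by lra.
by rewrite pmulr_rge0 ?subr_ge0 // !mulr_gt0.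
Qed.

Lemma dot_le u v : `|dot u v| <= enorm u * enorm v.
Proof.
rewrite ler_norml cauchy_schwarz andbT lerNl -dotNr.
by rewrite (le_trans (cauchy_schwarz _ _)) // enormN.
Qed.

Lemma enormD u v : enorm (u + v) <= enorm u + enorm v.
Proof.
rewrite -(@ler_pXn2r _ 2) ?nnegrE ?addr_ge0 ?enorm_ge0 //.
rewrite sqr_enorm dotDl !dotDr -!sqr_enorm [dot v u]dotC.
have := cauchy_schwarz u v; nra.
Qed.

Lemma enormB u v : enorm (u - v) <= enorm u + enorm v.
Proof. by rewrite (le_trans (enormD _ _)) ?enormN. Qed.

(** This and [enorm_le_norm] move bounds between the maximum norm, in which differentiability is
    expressed, and the Euclidean norm. *)
Lemma norm_le_enorm u : `|u| <= enorm u.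
Proof.
rewrite -[`|u|]/(mx_norm u) mx_normrE; apply: bigmax_le => [|[i j] _ /=].
  exact: enorm_ge0.
rewrite ord1 -sqrtr_sqr ler_wsqrtr // /dot (bigD1 j) //= -expr2 lerDl.
by apply: sumr_ge0 => k _; exact: sqr_ge0.
Qed.

Lemma coord_le_norm u i : `|u 0 i| <= `|u|.
Proof.
by rewrite -[`|u|]/(mx_norm u) mx_normrE; apply: (le_bigmax _ _ (0, i)).
Qed.

Lemma enorm_le_norm u : enorm u <= n%:R * `|u|.
Proof.
rewrite -(@ler_pXn2r _ 2) ?nnegrE ?mulr_ge0 ?enorm_ge0 // sqr_enorm exprMn.
apply: (@le_trans _ _ (\sum_(i < n) `|u| ^+ 2)).
  apply: ler_sum => i _; rewrite -expr2.
  by have := coord_le_norm u i; rewrite ler_norml; nra.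
rewrite sumr_const card_ord -[leLHS]mulr_natl ler_wpM2r ?sqr_ge0 //.
by rewrite -natrX ler_nat; case: (n) => // k; rewrite leq_pmulr.
Qed.

End euclid.

(** * Taylor expansion along increments close to a fixed direction *)

Section taylor.
Context {R : realType}.

Lemma differentiable_near (V W : normedModType R) (F : V -> W) p (e : R) :
  differentiable F p -> 0 < e -> exists2 d, 0 < d &
  forall h : V, `|h| < d -> `|F (p + h) - F p - 'd F p h| <= e * `|h|.
Proof.
move=> dF e0.
have : \forall h \near 0, `|F (p + h) - F p - 'd F p h| <= e * `|h|.
  near=> h; rewrite (diff_locallyxC dF) -addrA -opprD addrAC subrr add0r.
  by near: h; exact: littleoP.
move=> /nbhs_ballP[d /= d0 Hd]; exists d => // h hd; apply: Hd.
by rewrite -ball_normE /= sub0r normrN.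
Unshelve. all: by end_near. Qed.

(** Points of a set approached in direction [v] have increments [h] that are only close to [t *: v];
    since ['d F p] is bounded, the first order expansion remains valid for them. *)
Lemma differentiable_dir (V W : normedModType R) (F : V -> W) p v w (eps : R) :
  differentiable F p -> 'd F p v = w -> 0 < eps -> exists2 del, 0 < del &
  forall t h, 0 < t < del -> `|h - t *: v| <= del * t ->
    `|F (p + h) - F p - t *: w| <= eps * t.
Proof.
move=> dF <- e0.
have [K K0 HK] := linear_lipschitz (diff_continuous dF).
have v1 : 0 < `|v| + 1 by rewrite ltr_wpDl.
pose e := eps / 2 / (`|v| + 1).
have ep : 0 < e by rewrite !divr_gt0.
have [d d0 Hd] := differentiable_near dF ep.
(* The three bounds give, in turn, |h| <= t (|v| + 1), |h| < d, and the bound [eps / 2 * t] for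
   ['d F p] at [h - t *: v]. *)
pose del := Num.min 1 (Num.min (d / (`|v| + 1)) (eps / (2 * K))).
have [d1 d2 d3] : [/\ del <= 1, del <= d / (`|v| + 1) & del <= eps / (2 * K)].
  by rewrite /del; split; rewrite !ge_min lexx ?orbT.
exists del; first by rewrite !lt_min ltr01 !divr_gt0 ?mulr_gt0.
move=> t h /andP[t0 tdel] hh.
have h1 : `|h - t *: v| <= t.
  by rewrite (le_trans hh) // -[leRHS]mul1r ler_wpM2r // ltW.
have h2 : `|h| <= t * (`|v| + 1).
  rewrite -(subrK (t *: v) h) (le_trans (ler_normD _ _)) // normrZ gtr0_norm //.
  by rewrite mulrDr mulr1 addrC lerD2l.
have h3 : `|h| < d.
  rewrite (le_lt_trans h2) // -ltr_pdivlMr //; exact: lt_le_trans d2.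
rewrite -(subrK ('d F p h) (F (p + h) - F p)) -addrA.
rewrite (le_trans (ler_normD _ _)) // [eps in leRHS]splitr mulrDl lerD //.
  rewrite (le_trans (Hd _ h3)) // (le_trans (ler_wpM2l (ltW ep) h2)) //.
  by rewrite /e mulrCA divfK ?gt_eqF // mulrC.
rewrite -linearZ -linearB (le_trans (HK _)) //.
rewrite -ler_pdivlMl // (le_trans hh) // mulrA ler_wpM2r ?(ltW t0) //.
by rewrite (le_trans d3) // invfM mulrA mulrC.
Qed.

Lemma is_derive_line (V W : normedModType R) (f : V -> W) p h (x : R) :
  differentiable f (p + x *: h) ->
  is_derive x 1 (fun y : R => f (p + y *: h)) ('d f (p + x *: h) h).
Proof.
move=> df.
have dl : is_diff x (fun y : R => p + y *: h) (fun y : R => y *: h).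
  by apply: is_diff_eq; rewrite add0r.
have dfl : differentiable (f \o (fun y : R => p + y *: h)) x.
  by apply: differentiable_comp.
apply: DeriveDef; first exact: diff_derivable.
by rewrite deriveE // (@diff_comp _ _ _ _ (fun y : R => p + y *: h)) //= diff_val scale1r.
Qed.

(** Riesz representation; it turns a family of linear forms into a vector valued map. *)
Lemma dot_row_linear n (L : {linear 'rV[R]_n -> R^o}) v :
  dot (\row_i L (delta_mx 0 i)) v = L v.
Proof.
rewrite [in RHS](row_sum_delta v) linear_sum; apply: eq_bigr => i _.
by rewrite linearZ mxE mulrC.
Qed.

Lemma row_sumE n (V : Type) (g : 'I_n -> V -> R) :
  (fun x => \row_i g i x) = \sum_i (fun x => g i x *: delta_mx 0 i).
Proof.
apply/funext => x; rewrite [LHS]row_sum_delta fct_sumE.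
by apply: eq_bigr => i _; rewrite mxE.
Qed.

Lemma differentiable_row n (V : normedModType R) (g : 'I_n -> V -> R) x :
  (forall i, differentiable (g i) x) -> differentiable (fun x => \row_i g i x) x.
Proof.
move=> dg; rewrite row_sumE; apply: differentiable_sum => i.
exact: differentiableZl.
Qed.

Lemma is_derive_sub_quadratic (k : R -> R) (x dk a b : R) : is_derive x 1 k dk ->
  is_derive x 1 (fun y : R => k y - (y * a + y ^+ 2 * b)) (dk - (a + x * (2 * b))).
Proof.
move=> dkx; apply: is_derive_eq; congr (_ - _).
rewrite -[LHS]/(x * 0 + a * 1 + (x ^+ 2 * 0 + b * (x * 1 + x * 1))); ring.
Qed.

(* D and D0 stand for the differentials of f: they are kept abstract because
   comparing instances of 'd by conversion is prohibitively slow. *)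
Lemma taylor2_dir_of (n : nat) (f : 'rV[R]_n -> R)
    (D : 'rV[R]_n -> {linear 'rV[R]_n -> R^o}) (p v : 'rV[R]_n) (B M rad eps : R) D0 :
  (forall h, D p h = D0 h) -> 0 < eps -> 0 < rad -> 0 <= M ->
  (forall (h : 'rV[R]_n) (x : R), `|h| < rad -> 0 <= x <= 1 ->
     is_derive x 1 (fun y : R => f (p + y *: h)) (D (p + x *: h) h)) ->
  (exists2 d, 0 < d & forall (t : R) (h : 'rV[R]_n), 0 < t < d -> `|h - t *: v| <= d * t ->
     `|D (p + h) v - D p v - t * B| <= eps / 2 * t) ->
  (exists2 d, 0 < d & forall (t : R) (h : 'rV[R]_n), 0 < t < d -> `|h - t *: v| <= d * t ->
    forall u, `|D (p + h) u - D p u| <= M * t * `|u|) ->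
  exists2 d, 0 < d & forall (t : R) (h : 'rV[R]_n), 0 < t < d -> `|h - t *: v| <= d * t ->
    `|f (p + h) - f p - D0 h - t ^+ 2 / 2 * B| <= eps * t ^+ 2.
Proof.
move=> DD0 e0 rad0 M0 df [d1 d10 H1] [d2 d20 H2].
have M1 : 0 < M + 1 by rewrite ltr_wpDl.
have v1 : 0 < `|v| + 1 by rewrite ltr_wpDl.
pose del := Num.min (Num.min 1 (rad / (`|v| + 1)))
   (Num.min (eps / 2 / (M + 1)) (Num.min d1 d2)).
have [l1 l2 l3 [l4 l5]] : [/\ del <= 1, del <= rad / (`|v| + 1),
    del <= eps / 2 / (M + 1) & del <= d1 /\ del <= d2].
  by rewrite /del; split; [| | |split]; rewrite !ge_min lexx ?orbT.
have del0 : 0 < del by rewrite !lt_min ltr01 d10 d20 !divr_gt0.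
exists del => // t h /andP[t0 tdel] hh; rewrite -DD0.
have hrad : `|h| < rad.
  have : `|h| <= t * (`|v| + 1).
    rewrite -(subrK (t *: v) h) (le_trans (ler_normD _ _)) // normrZ gtr0_norm //.
    rewrite mulrDr mulr1 addrC lerD2l (le_trans hh) // -[leRHS]mul1r.
    by rewrite ler_wpM2r // ltW.
  by move=> /le_lt_trans; apply; rewrite -ltr_pdivlMr // (lt_le_trans tdel).
(* The quadratic correction is such that [g 1 - g 0] is the Taylor remainder, which the mean value
   theorem equates with [g' x]. *)
pose g x : R := f (p + x *: h) - (x * D p h + x ^+ 2 * (t ^+ 2 / 2 * B)).
pose g' x : R := D (p + x *: h) h - (D p h + x * (2 * (t ^+ 2 / 2 * B))).
have gg' (x : R) : 0 <= x <= 1 -> is_derive x 1 g (g' x).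
  by move=> x01; apply: is_derive_sub_quadratic; exact: df.
have [x] : exists2 x, x \in `]0, 1[ & g 1 - g 0 = g' x * (1 - 0).
  apply: MVT; rewrite ?ltr01 //.
    by move=> x; rewrite in_itv /= => /andP[x0 x1]; apply: gg'; rewrite !ltW.
  apply: derivable_within_continuous => x; rewrite in_itv /= => x01.
  by have [] := gg' x x01.
rewrite in_itv /= => /andP[x0 x1].
have -> : g 1 - g 0 = f (p + h) - f p - D p h - t ^+ 2 / 2 * B.
  rewrite /g scale1r scale0r addr0; ring.
rewrite subr0 mulr1 => ->.
pose u := h - t *: v.
have xt0 : 0 < x * t by rewrite mulr_gt0.
have xtt : x * t <= t by rewrite -[leRHS]mul1r ler_wpM2r // ltW.
(* The shrunken increment [x *: h] is admissible at time [x * t]. *)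
have hx : `|x *: h - (x * t) *: v| <= del * (x * t).
  rewrite -scalerA -scalerBr normrZ gtr0_norm // mulrCA.
  by rewrite ler_wpM2l // ltW.
have xt (d : R) : del <= d -> 0 < x * t < d.
  by move=> dd; rewrite xt0 (le_lt_trans xtt) // (lt_le_trans tdel).
have hxd (d : R) : del <= d -> `|x *: h - (x * t) *: v| <= d * (x * t).
  by move=> dd; rewrite (le_trans hx) // ler_wpM2r // ltW.
have {}H1 := H1 _ _ (xt _ l4) (hxd _ l4).
have {}H2 := H2 _ _ (xt _ l5) (hxd _ l5) u.
(* Split [h] as [t *: v + u]. The first term is controlled by the second derivative along [v]; the
   second is of order [t] times |u|, where |u| <= del * t. *)
have -> : g' x = t * (D (p + x *: h) v - D p v - x * t * B)
      + (D (p + x *: h) u - D p u).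
  have lin y : D y h = t * D y v + D y u.
    by rewrite -[h in LHS](subrK (t *: v)) -/u addrC linearD linearZ.
  by rewrite /g' !lin; field.
rewrite (le_trans (ler_normD _ _)) // [eps]splitr mulrDl lerD //.
  rewrite normrM gtr0_norm // expr2 mulrA [leRHS]mulrC ler_wpM2l ?(ltW t0) //.
  by rewrite (le_trans H1) // ler_wpM2l // ltW // divr_gt0.
rewrite (le_trans H2) //.
have -> : eps / 2 * t ^+ 2 = ((M + 1) * t) * (eps / 2 / (M + 1) * t).
  by field; rewrite gt_eqF.
apply: ler_pM => //; first by rewrite !mulr_ge0 // ltW.
  apply: ler_pM => //; [exact: ltW | by rewrite lerDl].
by rewrite (le_trans hh) // ler_wpM2r // ltW.
Qed.

(** The row [G x] of coordinates of [D x] is differentiable at [p], so it moves by at most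
    [(b + 1) * t]; Cauchy-Schwarz and the norm comparison transfer this to all [u]. *)
Lemma linear_family_dir (n : nat) (D : 'rV[R]_n -> {linear 'rV[R]_n -> R^o})
    (p v : 'rV[R]_n) :
  (forall w, differentiable (fun x => D x w) p) ->
  exists2 M : R, 0 <= M & exists2 d : R, 0 < d &
  forall (t : R) (h : 'rV[R]_n), 0 < t < d -> `|h - t *: v| <= d * t ->
    forall u, `|D (p + h) u - D p u| <= M * t * `|u|.
Proof.
move=> dD; pose G x := \row_i D x (delta_mx 0 i).
have dG : differentiable G p by exact: differentiable_row.
have [d d0 H] := differentiable_dir dG (erefl ('d G p v)) ltr01.
have [b Eb] : exists b, b = `|'d G p v| by exists `|'d G p v|.
have {}H (t : R) (h : 'rV[R]_n) : 0 < t < d -> `|h - t *: v| <= d * t ->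
    `|G (p + h) - G p| <= (b + 1) * t.
  move=> td hd; rewrite Eb -(subrK (t *: 'd G p v) (_ - _)).
  rewrite (le_trans (ler_normD _ _)) // mulrDl addrC lerD ?H //.
  by rewrite normrZ gtr0_norm ?(andP td).1 // mulrC.
have b0 : 0 <= b by rewrite Eb.
exists (n%:R * n%:R * (b + 1)); first by rewrite !mulr_ge0 // addr_ge0.
exists d => // t h td hd u; have {}H := H t h td hd.
rewrite -(dot_row_linear (D (p + h))) -(dot_row_linear (D p)) -/(G (p + h)) -/(G p) -dotBl.
rewrite (le_trans (dot_le _ _)) //.
rewrite (le_trans (ler_pM (enorm_ge0 _) (enorm_ge0 _) (enorm_le_norm _) (enorm_le_norm _))) //.
have -> : n%:R * n%:R * (b + 1) * t * `|u| = (n%:R * n%:R) * ((b + 1) * t * `|u|) by ring.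
by rewrite mulrACA ler_wpM2l // ler_wpM2r.
Qed.

(** The linear term keeps the exact increment [h], because replacing it by [t *: v] would cost an
    error that is only o(t). In the quadratic term this replacement is harmless. *)
Lemma taylor2_dir (n : nat) (f : 'rV[R]_n -> R) p v D0 (B eps : R) :
  (\forall x \near p, differentiable f x) ->
  (forall w, differentiable (fun x => 'd f x w) p) ->
  (forall h, 'd f p h = D0 h) -> 'd (fun x => 'd f x v) p v = B -> 0 < eps ->
  exists2 del, 0 < del &
  forall t h, 0 < t < del -> `|h - t *: v| <= del * t ->
    `|f (p + h) - f p - D0 h - t ^+ 2 / 2 * B| <= eps * t ^+ 2.
Proof.
move=> /nbhs_ballP[rad /= rad0 df] df2 fD0 fB e0.
have e20 : 0 < eps / 2 by rewrite divr_gt0.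
have [M M0 HM] := @linear_family_dir n (fun x => 'd f x) p v df2.
have H1 := differentiable_dir (df2 v) fB e20.
have dl (h : 'rV[R]_n) (x : R) : `|h| < rad -> 0 <= x <= 1 ->
    is_derive x 1 (fun y : R => f (p + y *: h)) ('d f (p + x *: h) h).
  move=> hrad /andP[x0 x1]; apply: is_derive_line; apply: df.
  rewrite -ball_normE /= opprD addrA subrr sub0r normrN normrZ ger0_norm //.
  by rewrite (le_lt_trans _ hrad) // -[leRHS]mul1r ler_wpM2r.
exact: (@taylor2_dir_of n f (fun x => 'd f x) p v B M rad eps D0 fD0 e0 rad0 M0 dl H1 HM).
Qed.
End taylor.

Section diff_near.
Context {R : realType} {V W : normedModType R}.

(** Both maps have the same first order expansion at [x], and the expansion determines the
    differential. *)
Lemma near_eq_diff (f g : V -> W) x :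
  (\forall y \near x, f y = g y) -> differentiable f x ->
  differentiable g x /\ 'd g x = 'd f x :> (V -> W).
Proof.
move=> fg df.
have fgx : f x = g x by apply: nbhs_singleton fg.
have E : g \o shift x = cst (g x) + 'd f x +o_ 0 id.
  apply/eqaddoP => e e0.
  have fg0 : \forall h \near 0, f (h + x) = g (h + x) by move: fg; rewrite (near_shift 0 x) subr0.
  near=> h.
  have -> : (g \o shift x - (cst (g x) + 'd f x)) h = (f \o shift x - (cst (f x) + 'd f x)) h.
    rewrite !fctE /= fgx; congr (_ - _).
    by apply/esym; near: h.
  near: h; move: e e0; apply/eqaddoP; exact: diff_locally.
have E2 := diff_unique (diff_continuous df) E.
split=> //; apply/diff_locallyP; rewrite E2; split => //; exact: diff_continuous.
Unshelve. all: by end_near. Qed.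

End diff_near.

Section dot_diff.
Context {R : realType} {n : nat}.

Definition dotl (w u : 'rV[R]_n) : R := dot u w.

Lemma dotl_linear w : linear (dotl w : 'rV[R]_n -> R^o).
Proof. by move=> c u v; rewrite /dotl dotDl dotZl. Qed.

HB.instance Definition _ w :=
  GRing.isLinear.Build R 'rV[R]_n R^o _ (dotl w) (@dotl_linear w).

Lemma dotl_continuous w : continuous (dotl w).
Proof.
move=> u; apply: differentiable_continuous.
have -> : dotl w = \sum_i (fun v : 'rV[R]_n => v 0 i * w 0 i).
  by apply/funext => v; rewrite fct_sumE.
apply: differentiable_sum => i.
apply: differentiableM => //; exact: differentiable_coord.
Qed.

Lemma diff_dotl (V : normedModType R) (F : V -> 'rV[R]_n) w x :
  differentiable F x ->
  differentiable (fun y => dot (F y) w) x /\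
  (forall u, 'd (fun y => dot (F y) w) x u = dot ('d F x u) w).
Proof.
move=> dF.
have dL : differentiable (dotl w : 'rV[R]_n -> R^o) (F x).
  exact/linear_differentiable/dotl_continuous.
split; first exact: (differentiable_comp dF dL).
move=> u; rewrite (diff_comp dF dL) /= diff_lin //; exact: dotl_continuous.
Qed.

End dot_diff.

Section second_order.
Context {R : realType}.

Lemma near_eq_diff2 (V W : normedModType R) (f g : V -> W) x :
  (\forall y \near x, f y = g y) -> (\forall y \near (x:V), differentiable f (y : V)) ->
  \forall y \near (x : V), differentiable g (y : V) /\ 'd g y = 'd f y :> (V -> W).
Proof.
(* [near_join] upgrades equality near [x] to equality near every [y] close to [x]. *)
move=> fg df; have {}fg := near_join fg; near=> y.
by apply: near_eq_diff; [near: y|near: y; exact: df].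
Unshelve. all: by end_near. Qed.

(** The formula for the first differential of [dot (F x) w] holds throughout a neighbourhood of [p],
    so it can be differentiated once more. *)
Lemma diff2_dotl (V : normedModType R) n (F : V -> 'rV[R]_n) w p :
  (\forall x \near p, differentiable F x) ->
  (forall u, differentiable (fun x => 'd F x u) p) ->
  [/\ \forall x \near p, differentiable (fun x => dot (F x) w) x,
      forall u, differentiable (fun x => 'd (fun x => dot (F x) w) x u) p &
      forall u v, 'd (fun x => 'd (fun x => dot (F x) w) x v) p u =
        dot ('d (fun x => 'd F x v) p u) w].
Proof.
move=> dF dF2.
have E u : \forall x \near p, dot ('d F x u) w = 'd (fun x => dot (F x) w) x u.
  by near=> x; rewrite (diff_dotl w _).2 //; near: x.
split=> [|u|u v].
- by near=> x; apply: (diff_dotl w _).1; near: x.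
- by have [] := near_eq_diff (E u) (diff_dotl w (dF2 u)).1.
- by have [_ ->] := near_eq_diff (E v) (diff_dotl w (dF2 v)).1; rewrite (diff_dotl w (dF2 v)).2.
Unshelve. all: by end_near. Qed.

Lemma taylor2_dotl n (F : 'rV[R]_n -> 'rV[R]_n) w p v (eps : R) :
  (\forall x \near p, differentiable F x) ->
  (forall u, differentiable (fun x => 'd F x u) p) -> 0 < eps ->
  exists2 del, 0 < del &
  forall t h, 0 < t < del -> `|h - t *: v| <= del * t ->
    `|dot (F (p + h)) w - dot (F p) w - dot ('d F p h) w
      - t ^+ 2 / 2 * dot (D2 F p v v) w| <= eps * t ^+ 2.
Proof.
move=> dF dF2 e0.
have [df df2 E2] := diff2_dotl w dF dF2.
exact: (taylor2_dir (f := fun x => dot (F x) w) df df2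
  (diff_dotl w (nbhs_singleton dF)).2 (E2 v v) e0).
Qed.

(** Passage to the limit in [e]; the restriction [e <= 1] allows [e ^+ 2] to be absorbed into
    [C * e]. *)
Lemma le_eps (x y C : R) :
  (forall e, 0 < e -> e <= 1 -> x <= y + C * e) -> x <= y.
Proof.
move=> H; rewrite leNgt; apply/negP => yx.
have C0 : 0 < `|C| + 1 by rewrite ltr_wpDl.
(* For this [e] the term [C * e] is at most half the gap [x - y]. *)
pose e := Num.min 1 ((x - y) / 2 / (`|C| + 1)).
have e0 : 0 < e by rewrite lt_min ltr01 !divr_gt0 ?subr_gt0.
have e1 : e <= 1 by rewrite /e ge_min lexx.
have e2 : e * (`|C| + 1) <= (x - y) / 2.
  by rewrite -ler_pdivlMr // /e ge_min lexx orbT.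
have := H e e0 e1; have := ler_norm C; nra.
Qed.

Lemma enorm_le_addr n (T : {vspace 'rV[R]_n}) u w :
  u \in T -> w \in orthv T -> enorm u <= enorm (u + w).
Proof.
move=> uT /memv_orthv/(_ u uT) uw.
rewrite -(@ler_pXn2r _ 2) ?nnegrE ?enorm_ge0 //.
rewrite !sqr_enorm dotDl !dotDr [dot w u]dotC uw.
by have := dot_ge0 w; lra.
Qed.

Lemma enorm_le_addl n (T : {vspace 'rV[R]_n}) u w :
  u \in T -> w \in orthv T -> enorm w <= enorm (u + w).
Proof.
move=> uT /memv_orthv/(_ u uT) uw.
rewrite -(@ler_pXn2r _ 2) ?nnegrE ?enorm_ge0 //.
rewrite !sqr_enorm dotDl !dotDr [dot w u]dotC uw.
by have := dot_ge0 u; lra.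
Qed.

Lemma oproj_id n (T : {vspace 'rV[R]_n}) u : u \in T -> oproj T u = u.
Proof. by move=> uT; rewrite /oproj daddv_pi_id ?capv_orthv. Qed.

Lemma oproj_add n (T : {vspace 'rV[R]_n}) u w :
  u \in T -> w \in orthv T -> oproj T (u + w) = u.
Proof.
move=> uT wT.
have cap0 : (orthv T :&: T = 0)%VS by rewrite capvC capv_orthv.
have w0 : oproj T w = 0.
  have wTT : w \in (T + orthv T)%VS by rewrite addv_orthv memvf.
  have := daddv_pi_add (capv_orthv T) wTT.
  by rewrite (daddv_pi_id cap0 wT) => /(canRL (addrK w)); rewrite subrr.
have -> : oproj T (u + w) = oproj T u + oproj T w by rewrite /oproj linearD.
by rewrite w0 addr0 oproj_id.
Qed.

Section supported.
Context {n : nat}.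
Variables (B : set 'rV[R]_n) (p nu : 'rV[R]_n) (r : R).
Hypothesis r0 : 0 < r.

(** For a unit vector [nu], this says that [B] avoids the open ball of radius [r] about
    [p + r *: nu], with the square expanded. *)
Definition supported := forall y, B y ->
  2 * r * dot (y - p) nu <= enorm (y - p) ^+ 2.

(** Contingent directions of [B] at [p], phrased with points of [B] instead of distances. *)
Definition reached v := forall eps, 0 < eps -> exists t y,
  [/\ 0 < t < eps, B y & enorm (y - p - t *: v) <= eps * t].

Hypothesis Bsup : supported.
Hypothesis nu1 : enorm nu = 1.

(** Here |y - p| <= t (|v| + e), and [e <= 1] bounds the square of |v| + e by |v|^2 + (2 |v| + 1)
    e. *)
Lemma supported_le t v y e : 0 < t -> 0 < e -> e <= 1 -> B y ->
  enorm (y - p - t *: v) <= e * t ->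
  2 * dot (y - p) nu <= t ^+ 2 * (r^-1 * enorm v ^+ 2 + r^-1 * (2 * enorm v + 1) * e).
Proof.
move=> t0 e0 e1 By yt.
have l : enorm (y - p) <= t * (enorm v + e).
  rewrite -(subrK (t *: v) (y - p)) (le_trans (enormD _ _)) // enormZ gtr0_norm //.
  by rewrite mulrDr addrC lerD2l mulrC [leRHS]mulrC mulrC.
have l2 : enorm (y - p) ^+ 2 <= t ^+ 2 * (enorm v + e) ^+ 2.
  by rewrite -exprMn lerXn2r // nnegrE ?enorm_ge0 // mulr_ge0 ?addr_ge0 ?enorm_ge0 // ltW.
have := le_trans (Bsup By) l2; rewrite mulrAC -ler_pdivlMr // => /le_trans; apply.
have -> : t ^+ 2 * (enorm v + e) ^+ 2 / r = t ^+ 2 * (r^-1 * (enorm v + e) ^+ 2) by ring.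
rewrite -mulrA -mulrDr; do 2![rewrite ler_wpM2l ?sqr_ge0 ?invr_ge0 ?(ltW r0) //].
have := enorm_ge0 v; nra.
Qed.

(** The bound of [supported_le] is quadratic in [t], while [dot (y - p) nu] is [t * dot v nu] up to
    [e * t]; after division by [t] only vanishing terms remain on the right. *)
Lemma reached_normal v : reached v -> dot v nu <= 0.
Proof.
move=> rv; apply: (@le_eps _ _ (r^-1 * (enorm v ^+ 2 + (2 * enorm v + 1)) + 1)).
move=> e e0 e1; have [t [y [/andP[t0 te] By yt]]] := rv _ e0.
have H := supported_le t0 e0 e1 By yt.
have : t * dot v nu <= dot (y - p) nu + e * t.
  have : - dot (y - p - t *: v) nu <= e * t.
    rewrite -dotNl (le_trans (cauchy_schwarz _ _)) // nu1 mulr1 enormN //.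
  by rewrite (dotBl _ (t *: v)) dotZl; lra.
have v0 := enorm_ge0 v.
have ri : 0 < r^-1 by rewrite invr_gt0.
(* [K] bounds the factor of [t ^+ 2] for all [e <= 1]; then [t < e] gives
   [t ^+ 2 * K <= t * e * K]. *)
pose K := r^-1 * (enorm v ^+ 2 + (2 * enorm v + 1)).
have HK : r^-1 * enorm v ^+ 2 + r^-1 * (2 * enorm v + 1) * e <= K.
  rewrite /K [leRHS]mulrDr lerD2l -mulrA ler_wpM2l ?(ltW ri) //; nra.
have K0 : 0 <= K by rewrite mulr_ge0 ?(ltW ri) ?addr_ge0 ?sqr_ge0 // mulr_ge0.
move=> H2; rewrite add0r -/K.
have : t * dot v nu <= t * ((K + 1) * e).
  have : t ^+ 2 * (r^-1 * enorm v ^+ 2 + r^-1 * (2 * enorm v + 1) * e) <= t ^+ 2 * K.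
    by rewrite ler_wpM2l ?sqr_ge0.
  have : t ^+ 2 * K <= t * e * K.
    by rewrite ler_wpM2r // expr2 ler_wpM2l // ltW.
  have : 0 <= t * e * K by apply: mulr_ge0 => //; apply: mulr_ge0; apply: ltW.
  nra.
by rewrite ler_pM2l.
Qed.

End supported.
End second_order.

(** * Approximation by graphs *)

Section graph_second_order.
Context {R : realType} {n : nat}.
Variables (B : set 'rV[R]_n) (p nu : 'rV[R]_n) (r : R).
Hypothesis r0 : 0 < r.
Hypothesis Bsup : supported B p nu r.
Hypothesis nu1 : enorm nu = 1.
Variables (T : {vspace 'rV[R]_n}) (f : 'rV[R]_n -> 'rV[R]_n).
Hypothesis fT : maps_to_orth T f.
Hypothesis gp : graph T f p.
Let F := f \o oproj T.
Hypothesis dF : forall x, differentiable F x.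
Hypothesis dF2 : forall u, differentiable (fun x => 'd F x u) p.
(** Common ground of the pointwise and the approximate case: points of [B] in direction [v] whose
    distance to the graph is of smaller order than [t ^+ 2]. *)
Hypothesis reach : forall v, v \in T -> forall eps, 0 < eps ->
  exists t y z, [/\ 0 < t < eps, B y, z \in T,
    enorm (y - p - t *: v) <= eps * t & enorm (y - (z + f z)) <= eps * t ^+ 2].

(** Take [h = z - s], where [p = s + f s]. The displacement between graph points splits orthogonally
    into [h] and the increment of [F], so one estimate controls both parts. *)
Lemma graph_point v t y z e : v \in T -> 0 < t -> 0 < e -> t <= 1 -> z \in T ->
  enorm (y - p - t *: v) <= e * t -> enorm (y - (z + f z)) <= e * t ^+ 2 ->
  exists h, [/\ h \in T, enorm (h - t *: v) <= 2 * e * t,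
    enorm (F (p + h) - F p) <= 2 * e * t &
    enorm (y - p - h - (F (p + h) - F p)) <= e * t ^+ 2].
Proof.
move=> vT t0 e0 t1 zT yt yz; have [s sT ps] := gp.
have Fp : F p = f s by rewrite /F /= -ps oproj_add // fT.
have Fph : F (p + (z - s)) = f z.
  rewrite /F /= -ps [X in oproj _ X](_ : _ = z + f s) ?oproj_add ?fT //.
  by apply/rowP => i; rewrite !mxE; ring.
have E : (z - s - t *: v) + (f z - f s) = (y - p - t *: v) - (y - (z + f z)).
  rewrite -ps; apply/rowP => i; rewrite !mxE; ring.
have H : enorm ((z - s - t *: v) + (f z - f s)) <= 2 * e * t.
  rewrite E (le_trans (enormB _ _)) //.
  have : e * t ^+ 2 <= e * t by rewrite ler_wpM2l ?(ltW e0) // expr2 ler_piMl // ltW.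
  by lra.
have hT : z - s \in T by rewrite memvB.
have h1 : z - s - t *: v \in T by rewrite memvB // memvZ.
have h2 : f z - f s \in orthv T by rewrite memvB // fT.
exists (z - s); rewrite Fph Fp; split => //.
- exact: le_trans (enorm_le_addr h1 h2) H.
- exact: le_trans (enorm_le_addl h1 h2) H.
- rewrite [X in enorm X](_ : _ = y - (z + f z)) //.
  by rewrite -ps; apply/rowP => i; rewrite !mxE; ring.
Qed.

(** The increment of [F] is the component orthogonal to [T], hence at most [2 * e * t], although the
    points move along [v]; its first order part must vanish. *)
Lemma reach_tangent v : v \in T -> 'd F p v = 0.
Proof.
move=> vT; have [w dv] : exists w, 'd F p v = w by exists ('d F p v).
rewrite dv; apply/eqP; rewrite -normr_le0.
(* One [e] comes from the expansion of [F], two from [graph_point]. *)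
apply: (@le_eps _ _ _ 3) => e e0 e1.
have [d d0 H] := differentiable_dir (dF p) dv e0.
pose e' := Num.min e (d / 2).
have e'0 : 0 < e' by rewrite lt_min e0 divr_gt0.
have [l1 l2] : e' <= e /\ e' <= d / 2 by rewrite /e' !ge_min !lexx ?orbT.
have [t [y [z [/andP[t0 te] By zT yt yz]]]] := reach vT e'0.
have [h [hT hv Fh _]] := graph_point vT t0 e'0 (ltac:(lra)) zT yt yz.
have := H t h; rewrite t0 /= => /(_ ltac:(lra)).
have hd : `|h - t *: v| <= d * t.
  rewrite (le_trans (norm_le_enorm _)) // (le_trans hv) // ler_wpM2r ?(ltW t0) //; lra.
move=> /(_ hd) Hd.
have : `|t *: w| <= 3 * e * t.
  rewrite -(subKr (F (p + h) - F p) (t *: w)) (le_trans (ler_normB _ _)) //.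
  have := le_trans (norm_le_enorm _) Fh.
  have : 2 * e' * t <= 2 * e * t by rewrite ler_wpM2r ?(ltW t0) //; lra.
  lra.
by rewrite normrZ gtr0_norm // mulrC ler_pM2r // add0r.
Qed.

Lemma graph_reached v : v \in T -> reached B p v.
Proof.
by move=> vT e /(reach vT)[t [y [z [? ? _ ? _]]]]; exists t, y.
Qed.

(** Both [v] and [- v] are reached directions. *)
Lemma graph_normal v : v \in T -> dot v nu = 0.
Proof.
move=> vT; apply/eqP; rewrite eq_le.
have H u (uT : u \in T) := reached_normal r0 Bsup nu1 (graph_reached uT).
by rewrite H //= -oppr_le0 -dotNl H // memvN.
Qed.

(** For [h] in [T] both ['d F p h] and [dot h nu] vanish, so only the second order terms are left to
    be compared by [supported_le]. *)
Lemma graph_second_order v : v \in T ->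
  dot (D2 F p v v) nu <= r^-1 * enorm v ^+ 2.
Proof.
move=> vT.
have [b Eb] : exists b, dot (D2 F p v v) nu = b by exists (dot (D2 F p v v) nu).
have taylor (e : R) : 0 < e -> exists2 d, 0 < d & forall t h, 0 < t < d -> h \in T ->
    `|h - t *: v| <= d * t ->
    t ^+ 2 / 2 * b <= dot (F (p + h)) nu - dot (F p) nu + e * t ^+ 2.
  move=> e0; have dFp : \forall x \near p, differentiable F x by apply: filterE; exact: dF.
  have [d d0 H] := taylor2_dotl nu v dFp dF2 e0.
  exists d => // t h td hT ht; have := H t h td ht.
  rewrite (reach_tangent hT) [dot 0 _]dotC dot0r subr0 ler_norml Eb => /andP[Hd _]; lra.
(* The first summand comes from [supported_le]; 4 is twice the Taylor error plus twice the distance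
   to the graph. *)
rewrite Eb; apply: (@le_eps _ _ _ (r^-1 * (2 * enorm v + 1) + 4)) => e e0 e1.
have [d d0 H] := taylor e e0.
pose e' := Num.min e (d / 2).
have e'0 : 0 < e' by rewrite lt_min e0 divr_gt0.
have [l1 l2] : e' <= e /\ e' <= d / 2 by rewrite /e' !ge_min !lexx ?orbT.
have [t [y [z [/andP[t0 te] By zT yt yz]]]] := reach vT e'0.
have t1 : t <= 1 by rewrite (le_trans (ltW te)) // (le_trans l1).
have td : 0 < t < d by rewrite t0; lra.
have [h [hT hv _ yh]] := graph_point vT t0 e'0 t1 zT yt yz.
have hd : `|h - t *: v| <= d * t.
  rewrite (le_trans (norm_le_enorm _)) // (le_trans hv) // ler_wpM2r ?(ltW t0) //; lra.
have Hd := H t h td hT hd.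
have yt' : enorm (y - p - t *: v) <= e * t.
  by rewrite (le_trans yt) // ler_wpM2r // ltW.
have Hs := supported_le r0 Bsup t0 e0 e1 By yt'.
have He : - dot (y - p - h - (F (p + h) - F p)) nu <= e * t ^+ 2.
  rewrite -dotNl (le_trans (cauchy_schwarz _ _)) // nu1 mulr1 enormN (le_trans yh) //.
  by rewrite ler_wpM2r ?sqr_ge0.
rewrite (dotBl _ (F _ - F _)) (dotBl _ h) (dotBl (F _)) (graph_normal hT) in He.
have t20 : 0 < t ^+ 2 by rewrite exprn_gt0.
rewrite -(ler_pM2l t20); move: (dot _ nu) (dot _ nu) (dot _ nu) Hs Hd He => x1 x2 x3; lra.
Qed.

End graph_second_order.

(** * Points of a set extracted from limit conditions *)

Section near_zero.
Context {R : realType} {n : nat}.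
Implicit Types (A B : set 'rV[R]_n) (a p x y v nu : 'rV[R]_n).

Lemma cvg_right0_lt (f : R -> \bar R) (e : R) : f @ 0^'+ --> 0%E -> 0 < e ->
  exists2 d, 0 < d & forall t, 0 < t < d -> (f t < e%:E)%E.
Proof.
move=> f0 e0.
have /f0 [d /= d0 H] := @nbhs_open_ereal_lt R 0 (cst e) e0.
exists d => // t /andP[t0 td]; apply: H => //=.
by rewrite /ball /= sub0r normrN gtr0_norm.
Qed.

Lemma edist_lt A x (d : R) : (Defs.edist A x < d%:E)%E -> exists2 y, A y & enorm (x - y) < d.
Proof. by move=> /ereal_inf_lt[_ [y Ay <-]]; rewrite lte_fin; exists y. Qed.

Lemma Tan_lower_reached A a v (e : R) : Tan_lower A a v -> 0 < e ->
  exists2 d, 0 < d & forall t, 0 < t < d ->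
    exists2 y, A y & enorm (y - a - t *: v) <= e * t.
Proof.
move=> Av e0; have [d d0 H] := cvg_right0_lt Av e0.
exists d => // t td; have t0 : 0 < t by case/andP: td.
have := H t td; rewrite lte_pdivrMl // -EFinM => /edist_lt[y Ay yt].
exists y => //; rewrite -addrA -opprD enorm_distC mulrC; exact: ltW.
Qed.

(** Where the two cones coincide, membership in the upper one yields the limit that defines the
    lower one, which provides points at all small [t]. *)
Lemma Tan_reached A a v : Tan A a v -> reached A a v.
Proof.
move=> [AA Av] e e0; have [d d0 H] : exists2 d, 0 < d & forall t, 0 < t < d ->
    exists2 y, A y & enorm (y - a - t *: v) <= e * t.
  by apply: Tan_lower_reached => //; rewrite -AA.
pose t := Num.min (e / 2) (d / 2).
have t0 : 0 < t by rewrite lt_min !divr_gt0.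
have [te td] : t <= e / 2 /\ t <= d / 2 by rewrite /t !ge_min !lexx orbT.
have [|y Ay yt] := H t; first by rewrite t0; lra.
by exists t, y; split=> //; rewrite t0; lra.
Qed.

Lemma supported_ball A a nu (r : R) : enorm nu = 1 -> 0 < r ->
  eoball (a + r *: nu) r `&` A = set0 -> supported A a nu r.
Proof.
move=> nu1 r0 A0 y Ay; have : ~ eoball (a + r *: nu) r y.
  by move=> By; have : set0 y by rewrite -A0.
rewrite /eoball /= => /negP; rewrite -leNgt => ry.
have : r ^+ 2 <= enorm (y - (a + r *: nu)) ^+ 2.
  by rewrite lerXn2r // nnegrE ?enorm_ge0 // ltW.
rewrite opprD addrA; move: (y - a) => w; rewrite !sqr_enorm !(dotBl, dotBr, dotZl, dotZr).
by rewrite -[dot nu nu]sqr_enorm nu1 [dot nu _]dotC; lra.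
Qed.

(** The limit is used at radius [c * t] with threshold [e / c ^+ 2], so that rescaling returns
    [e * t ^+ 2]. *)
Lemma sup_edist_reached (M A : set 'rV[R]_n) a (e c : R) :
  ((fun r : R => (r ^- 2)%:E * ereal_sup [set Defs.edist M x | x in ecball a r `&` A])%E
    @ 0^'+ --> 0%E) -> 0 < e -> 0 < c ->
  exists2 d, 0 < d & forall t y, 0 < t < d -> A y -> enorm (y - a) <= c * t ->
    exists2 z, M z & enorm (y - z) <= e * t ^+ 2.
Proof.
move=> MA e0 c0.
have e1 : 0 < e / c ^+ 2 by rewrite divr_gt0 // exprn_gt0.
have [d d0 H] := cvg_right0_lt MA e1.
exists (d / c); first exact: divr_gt0.
move=> t y /andP[t0 td] Ay yt.
have ct0 : 0 < c * t by rewrite mulr_gt0.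
have := H (c * t); rewrite ct0 mulrC -ltr_pdivlMr // td => /(_ isT).
rewrite mulrC lte_pdivrMl ?exprn_gt0 // -EFinM => ylt.
have /edist_lt[z Mz yz] : (Defs.edist M y < (e * t ^+ 2)%:E)%E.
  rewrite (_ : e * t ^+ 2 = (c * t) ^+ 2 * (e / c ^+ 2)); last by field; rewrite gt_eqF.
  by apply: le_lt_trans ylt; apply: ereal_sup_ubound; exists y.
by exists z => //; exact: ltW.
Qed.

End near_zero.

Section pointwise_case.
Context {R : realType} {n : nat}.

(** The tangent cone supplies points of [A] in direction [v], and the quadratic limit supplies graph
    points close to them, as [graph_second_order] requires. *)
Lemma pointwise_second_order (A : set 'rV[R]_n) a nu (r : R)
    (S : {vspace 'rV[R]_n}) D :
  0 < r -> enorm nu = 1 -> supported A a nu r ->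
  [set` S] = Tan A a -> is_ptD2 A a S D ->
  forall v, Tan A a v -> dot (D v v) nu <= r^-1 * enorm v ^+ 2.
Proof.
move=> r0 nu1 Asup SE [f [fS [dF dF2] fa [_ fA] ->]] v.
rewrite -[Tan A a]SE /= => vS.
apply: (graph_second_order r0 Asup nu1 fS fa) => //.
- by move=> x; exact: dF.
- by move=> u; apply: (dF2 u).1.
move=> {v vS} v vS e e0.
have Sv : Tan A a v by rewrite -SE.
have Av : Tan_lower A a v by case: Sv => <-.
have [d1 d10 H1] := Tan_lower_reached Av e0.
(* Points with |y - a - t v| <= e t lie within (|v| + e) t of [a]. *)
have c0 : 0 < enorm v + e by rewrite ltr_wpDl ?enorm_ge0.
have [d2 d20 H2] := sup_edist_reached fA e0 c0.
pose t := Num.min (e / 2) (Num.min (d1 / 2) (d2 / 2)).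
have t0 : 0 < t by rewrite !lt_min !divr_gt0.
have [te [td1 td2]] : t <= e / 2 /\ t <= d1 / 2 /\ t <= d2 / 2.
  by rewrite /t !ge_min !lexx !orbT.
have [|y Ay yt] := H1 t; first by rewrite t0; lra.
have [|//||_ [z zS <-] yz] := H2 t y.
- by rewrite t0; lra.
- rewrite -(subrK (t *: v) (y - a)) (le_trans (enormD _ _)) // enormZ gtr0_norm //.
  by rewrite addrC mulrDl lerD // mulrC.
by exists t, y, z; split=> //; rewrite t0; lra.
Qed.

End pointwise_case.

(** * Submanifolds *)

Section c1.
Context {R : realType} {V : normedModType R}.

(** Class 1 at a single point: it can be verified by different formulas at different points, as
    happens inside and outside the support of a cutoff. *)
Definition c1_at (W : normedModType R) (F : V -> W) x :=
  (\forall y \near x, differentiable F y) /\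
  (forall v, {for x, continuous (fun y => 'd F y v)}).

Lemma c1_at_of (W : normedModType R) (F : V -> W) x (D : V -> V -> W) :
  (\forall y \near x, differentiable F y) ->
  (\forall y \near x, forall v, 'd F y v = D y v) ->
  (forall v, {for x, continuous (fun y => D y v)}) -> c1_at F x.
Proof.
move=> dF FD Dc; split=> // v.
have E : \forall y \near x, D y v = 'd F y v.
  by apply: filterS FD => y ->.
rewrite /prop_for /continuous_at -(nbhs_singleton E).
apply: cvg_trans (Dc v); apply: near_eq_cvg E.
Qed.

Lemma near_eq_c1 (W : normedModType R) (F G : V -> W) x :
  (\forall y \near x, F y = G y) -> c1_at F x -> c1_at G x.
Proof.
move=> FG [dF cF]; have H := near_eq_diff2 FG dF.
apply: (@c1_at_of _ _ _ (fun y => 'd F y)) => //.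
  by apply: filterS H => y [].
by apply: filterS H => y [_ E] v; rewrite E.
Qed.

Lemma c1_cst (W : normedModType R) (c : W) x : c1_at (fun=> c) x.
Proof.
apply: (@c1_at_of _ _ _ (fun _ _ => 0)).
- by apply: filterE => y; exact: differentiable_cst.
- by apply: filterE => y v; have := @diff_cst _ V W c y; rewrite /cst => ->.
- by move=> v; exact: cst_continuous.
Qed.

Lemma c1D (W : normedModType R) (f g : V -> W) x : c1_at f x -> c1_at g x ->
  c1_at (fun y => f y + g y) x.
Proof.
move=> [df cf] [dg cg].
apply: (@c1_at_of _ _ _ (fun y v => 'd f y v + 'd g y v)).
- by apply: filterS2 df dg => y; exact: differentiableD.
- apply: filterS2 df dg => y dfy dgy v.
  by have := diffD dfy dgy; rewrite /GRing.add /= => ->.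
- by move=> v; apply: cvgD; [exact: cf | exact: cg].
Qed.

Lemma diffM_ext (f g : V -> R) y v : differentiable f y -> differentiable g y ->
  'd (fun z => f z * g z) y v = f y * 'd g y v + g y * 'd f y v.
Proof. by move=> df dg; have := diffM df dg; rewrite /GRing.mul /= => ->. Qed.

Lemma c1M (f g : V -> R) x : c1_at f x -> c1_at g x ->
  c1_at (fun y => f y * g y) x.
Proof.
move=> [df cf] [dg cg].
have cf0 := differentiable_continuous (nbhs_singleton df).
have cg0 := differentiable_continuous (nbhs_singleton dg).
apply: (@c1_at_of _ _ _ (fun y v => f y * 'd g y v + g y * 'd f y v)).
- by apply: filterS2 df dg => y; exact: differentiableM.
- by apply: filterS2 df dg => y dfy dgy v; exact: diffM_ext.
- move=> v; apply: cvgD; apply: cvgM => //; [exact: cg | exact: cf].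
Qed.

Lemma c1_sum n (f : 'I_n -> V -> R) x : (forall i, c1_at (f i) x) ->
  c1_at (fun y => \sum_i f i y) x.
Proof.
move=> cf; elim: n f cf => [|n IH] f cf.
  by apply: near_eq_c1 (c1_cst (0 : R) x); apply: filterE => y; rewrite big_ord0.
apply: (@near_eq_c1 _ (fun y => f ord0 y + \sum_i f (lift ord0 i) y)).
  by apply: filterE => y; rewrite big_ord_recl.
by apply: c1D => //; exact: IH.
Qed.

Lemma c1_comp (th dth : R -> R) (s : V -> R) x :
  (forall u : R, is_derive u 1 th (dth u)) -> {for s x, continuous dth} ->
  c1_at s x -> c1_at (fun y => th (s y)) x.
Proof.
move=> dthE cth [ds cs].
have dth' u : differentiable th u by apply/derivable1_diffP; have [] := dthE u.
apply: (@c1_at_of _ _ _ (fun y v => dth (s y) * 'd s y v)).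
- by apply: filterS ds => y dy; exact: differentiable_comp.
- apply: filterS ds => y dy v.
  have -> := diff_comp dy (dth' (s y)); rewrite /=.
  have -> : 'd th (s y) = *:%R^~ (dth (s y)) :> (R -> R).
    have [dv E] := dthE (s y); rewrite (diff1E (dth' _)) derive1E E //.
  by rewrite mulrC.
- move=> v; apply: cvgM; last exact: cs.
  apply: continuous_comp => //.
  exact: differentiable_continuous (nbhs_singleton ds).
Qed.

End c1.

Lemma dot_delta {R : realType} {n} (u : 'rV[R]_n) i : dot u (delta_mx 0 i) = u 0 i.
Proof.
rewrite /dot (bigD1 i) //= mxE !eqxx mulr1 big1 ?addr0 // => j ji.
by rewrite mxE (negPf ji) andbF mulr0.
Qed.

Lemma c1_dotl {R : realType} {n} (w x : 'rV[R]_n) : c1_at (fun y => dot y w) x.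
Proof.
have H y : differentiable (dotl w : 'rV[R]_n -> R^o) y.
  exact/linear_differentiable/dotl_continuous.
apply: (@c1_at_of _ _ _ _ _ (fun _ v => dot v w)).
- by apply: filterE => y; exact: H.
- apply: filterE => y v.
  have -> : (fun z => dot z w) = (dotl w : 'rV[R]_n -> R^o) by [].
  by rewrite diff_lin //; exact: dotl_continuous.
- by move=> v; exact: cst_continuous.
Qed.

(** * A bump function of class 1 *)

Section cutoff.
Context {R : realType}.

(** The square of the positive part of [u], written without case distinction. *)
Definition sqpos (u : R) := u * (u + `|u|) / 2.

(** Away from 0 the function is locally [x ^+ 2] or its negative; at 0 the difference quotient is
    |h|. *)
Lemma is_derive_mul_norm (u : R) : is_derive u 1 (fun x => x * `|x|) (2 * `|u|).
Proof.
have [u0|u0|->] := ltgtP u 0.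
- have E : \forall x \near u, - (x ^+ 2) = x * `|x|.
    near=> x; have x0 : x < 0 by near: x; exact: lt_nbhsl.
    by rewrite ltr0_norm // mulrN expr2.
  apply: (near_eq_is_derive E).
  apply: is_derive_eq; rewrite ltr0_norm // -[LHS]/(- ((u * 1 + u * 1))); ring.
- have E : \forall x \near u, x ^+ 2 = x * `|x|.
    near=> x; have x0 : 0 < x by near: x; exact: lt_nbhsr.
    by rewrite gtr0_norm // expr2.
  apply: (near_eq_is_derive E).
  apply: is_derive_eq; rewrite gtr0_norm // -[LHS]/((u * 1 + u * 1)); ring.
- have H : (fun h : R => h^-1 *:
      (((fun x : R => x * `|x|) \o shift (0 : R)) (h *: (1 : R)) - 0 * `|0 : R| : R)) @ 0^'
      --> (0 : R).
    apply/cvgr0Pnorm_le => e e0; near=> h.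
    have h0 : h != 0 by near: h; exact: nbhs_dnbhs_neq.
    have he : `|h| <= e by near: h; apply: dnbhs0_le.
    rewrite /= addr0 mul0r subr0 -[h *: 1]/(h * 1) mulr1 -[h^-1 *: _]/(h^-1 * _).
    by rewrite mulKf // normr_id.
  rewrite normr0 mulr0; apply: DeriveDef; first exact: (cvgP _ H).
  exact: cvg_lim H.
Unshelve. all: by end_near. Qed.

Lemma is_derive_sqpos (u : R) : is_derive u 1 sqpos (u + `|u|).
Proof.
have -> : sqpos = (fun x => 2^-1 * (x ^+ 2 + x * `|x|)).
  by apply/funext => x; rewrite /sqpos; field.
have Hu := is_derive_mul_norm u.
apply: is_derive_eq.
by rewrite -[LHS]/(2^-1 * (u * 1 + u * 1 + 2 * `|u|)); field.
Qed.

Lemma sqpos_le0 u : u <= 0 -> sqpos u = 0.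
Proof. by move=> u0; rewrite /sqpos ler0_norm // subrr mulr0 mul0r. Qed.

Lemma sqpos_ge0 u : 0 <= u -> sqpos u = u ^+ 2.
Proof. by move=> u0; rewrite /sqpos ger0_norm //; field. Qed.

Lemma continuous_norm_add (u : R) : {for u, continuous (fun x : R => x + `|x|)}.
Proof. by apply: cvgD; [exact: cvg_id | exact: norm_continuous]. Qed.

(* The C^1 bump function ((rho^2 - |x - a|^2)^+)^2 / rho^4. *)
Lemma c1_cutoff n (a : 'rV[R]_n) (rho : R) : 0 < rho ->
  exists chi : 'rV[R]_n -> R,
  [/\ chi a = 1, forall x, c1_at chi x,
      forall x, rho <= enorm (x - a) -> chi x = 0 &
      forall x, rho < enorm (x - a) -> \forall y \near x, chi y = 0].
Proof.
move=> rho0; pose s (x : 'rV[R]_n) := rho ^+ 2 - enorm (x - a) ^+ 2.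
have c1s x : c1_at s x.
  apply: (@near_eq_c1 _ _ _ (fun x : 'rV[R]_n => rho ^+ 2 +
     \sum_i ((-1) * ((x 0 i - a 0 i) * (x 0 i - a 0 i))))).
    apply: filterE => y; rewrite /s sqr_enorm /dot -sumrN; congr (_ + _).
    by apply: eq_bigr => i _; rewrite !mxE mulN1r.
  apply: c1D; first exact: c1_cst.
  apply: c1_sum => i; apply: c1M; first exact: c1_cst.
  have c1i : c1_at (fun x : 'rV[R]_n => x 0 i - a 0 i) x.
    apply: c1D; last exact: c1_cst.
    apply: near_eq_c1 (c1_dotl (delta_mx 0 i) x).
    by apply: filterE => y; rewrite dot_delta.
  exact: c1M.
have cs x : {for x, continuous s}.
  exact: (differentiable_continuous (nbhs_singleton (c1s x).1)).
have sneg x : rho <= enorm (x - a) -> s x <= 0.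
  by move=> h; rewrite subr_le0 lerXn2r // nnegrE ?enorm_ge0 // ltW.
exists (fun x => (rho ^+ 4)^-1 * sqpos (s x)); split.
- rewrite /s subrr enorm0 expr0n subr0 sqpos_ge0 ?sqr_ge0 // -exprM mulVf //.
  by rewrite expf_neq0 // gt_eqF.
- move=> x; apply: c1M; first exact: c1_cst.
  by apply: (c1_comp is_derive_sqpos); [exact: continuous_norm_add|].
- by move=> x /sneg h; rewrite sqpos_le0 // mulr0.
- move=> x h; have sx : s x < 0.
    by rewrite subr_lt0 ltr_pXn2r ?nnegrE ?enorm_ge0 // ltW.
  have : \forall y \near x, s y < 0 by apply: (cvgr_lt _ (cs x)).
  by apply: filterS => y sy; rewrite sqpos_le0 ?mulr0 // ltW.
Qed.

End cutoff.

Lemma diff_comp_apply {R : realType} {U V W : normedModType R} (f : U -> V)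
    (g : V -> W) x u : differentiable f x -> differentiable g (f x) ->
  'd (g \o f) x u = 'd g (f x) ('d f x u).
Proof. by move=> df dg; rewrite (diff_comp df dg). Qed.

Lemma diff_id_apply {R : realType} {V : normedModType R} (x u : V) :
  'd (fun y : V => y) x u = u.
Proof.
have E : 'd (id : V -> V) x = id :> (V -> V) by rewrite diff_val.
by rewrite -[LHS]/('d (id : V -> V) x u) E.
Qed.

(** * Conormal vectors in a chart *)

Section chart.
Context {R : realType} {n : nat}.
Implicit Types (A U : set 'rV[R]_n) (a x u v w nu : 'rV[R]_n).

(** At points of [A] in direction [u] the increment of [f] is 0, and it is also [t * 'd f x u] up to
    [e * t]. *)
Lemma reached_diff_eq0 (f : 'rV[R]_n -> R) A x u : differentiable f x ->
  (\forall y \near x, A y -> f y = f x) -> reached A x u -> 'd f x u = 0.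
Proof.
move=> df /nbhs_ballP[rho /= rho0 fA] xu.
have [b Eb] : exists b, 'd f x u = b by exists ('d f x u).
rewrite Eb; apply/eqP; rewrite -normr_le0; apply: (@le_eps _ _ _ 1) => e e0 _.
have [d d0 H] := differentiable_dir df Eb e0.
have u1 : 0 < enorm u + 1 by rewrite ltr_wpDl ?enorm_ge0.
(* The last bound keeps [y] in the ball on which [f] is constant along [A]. *)
pose e' := Num.min 1 (Num.min d (rho / (enorm u + 1))).
have e'0 : 0 < e' by rewrite !lt_min ltr01 d0 divr_gt0.
have [l1 [l2 l3]] : e' <= 1 /\ e' <= d /\ e' <= rho / (enorm u + 1).
  by rewrite /e' !ge_min !lexx !orbT.
have [t [y [/andP[t0 te] Ay yt]]] := xu _ e'0.
have fy : f y = f x.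
  apply: fA => //; rewrite -ball_normE /= distrC.
  rewrite (le_lt_trans (norm_le_enorm _)) // -(subrK (t *: u) (y - x)).
  rewrite (le_lt_trans (enormD _ _)) // enormZ gtr0_norm //.
  apply: (@le_lt_trans _ _ (t * (enorm u + 1))).
    by rewrite mulrDr mulr1 addrC lerD2l (le_trans yt) // -[leRHS]mul1r ler_wpM2r // ltW.
  by rewrite -ltr_pdivlMr // (lt_le_trans te).
have := H t (y - x); rewrite t0 (lt_le_trans te l2) => /(_ isT).
have hd : `|y - x - t *: u| <= d * t.
  by rewrite (le_trans (norm_le_enorm _)) // (le_trans yt) // ler_wpM2r // ltW.
move=> /(_ hd); rewrite [x + _]addrC subrK fy subrr sub0r normrN normrZ gtr0_norm //.
by rewrite mulrC ler_pM2r // add0r mul1r.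
Qed.

(** [w] represents the form taking [z] to [dot ('d psi q z) nu]. Short segments in [Z] from [q] pull
    back to points of [A], so ['d psi q] maps [Z] to reached directions, which are normal to [nu];
    hence the form annihilates [Z]. *)
Lemma chart_conormal A a nu (r : R) U phi psi (Z : {vspace 'rV[R]_n}) :
  0 < r -> enorm nu = 1 -> supported A a nu r -> A a ->
  open U -> U a -> (forall x, U x -> differentiable phi x) ->
  open (phi @` U) -> (forall y, (phi @` U) y -> differentiable psi y) ->
  (forall x, U x -> psi (phi x) = x) ->
  phi @` (A `&` U) = [set` Z] `&` phi @` U ->
  exists w, (forall u, dot ('d phi a u) w = dot u nu) /\
    (forall x, A x -> U x -> dot (phi x) w = dot (phi a) w).
Proof.
move=> r0 nu1 Asup Aa oU Ua dphi oV dpsi psiK AZ.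
pose q := phi a; have Vq : (phi @` U) q by exists a.
have dpsiq := dpsi _ Vq.
have ZA x : A x -> U x -> phi x \in Z.
  by move=> Ax Ux; have : (phi @` (A `&` U)) (phi x) by [exists x]; rewrite AZ => -[].
have psiZ z : z \in Z -> dot ('d psi q z) nu = 0.
  have reachZ z' : z' \in Z -> reached A a ('d psi q z').
    move=> z'Z e e0.
    have [b Eb] : exists b, 'd psi q z' = b by exists ('d psi q z').
    rewrite Eb.
    (* [n.+1] absorbs the factor of the norm comparison and is positive even in dimension 0. *)
    have en0 : 0 < e / n.+1%:R by rewrite divr_gt0.
    have [d d0 H] := differentiable_dir dpsiq Eb en0.
    have /nbhs_ballP[rho /= rho0 HV] := open_nbhs_nbhs (conj oV Vq).
    have z1 : 0 < `|z'| + 1 by rewrite ltr_wpDl.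
    pose t := Num.min (e / 2) (Num.min (d / 2) (rho / 2 / (`|z'| + 1))).
    have t0 : 0 < t by rewrite !lt_min !divr_gt0.
    have [l1 [l2 l3]] : t <= e / 2 /\ t <= d / 2 /\ t <= rho / 2 / (`|z'| + 1).
      by rewrite /t !ge_min !lexx !orbT.
    have Vt : (phi @` U) (q + t *: z').
      apply: HV; rewrite -ball_normE /= opprD addrA subrr sub0r normrN normrZ gtr0_norm //.
      move: l3; rewrite ler_pdivlMr //; have := normr_ge0 z'; nra.
    have : ([set` Z] `&` phi @` U) (q + t *: z').
      by split=> //=; rewrite memvD ?memvZ // ZA.
    rewrite -AZ => -[x [Ax Ux] phix].
    have Ht := H t (t *: z'); rewrite subrr normr0 -phix !psiK // in Ht.
    exists t, x; split=> //; first by rewrite t0; lra.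
    rewrite (le_trans (enorm_le_norm _)) //.
    have : `|x - a - t *: b| <= e / n.+1%:R * t.
      by apply: Ht; [rewrite t0; lra | rewrite mulr_ge0 // ltW].
    move=> /(ler_wpM2l (ler0n R n)) /le_trans; apply.
    rewrite mulrA ler_wpM2r ?(ltW t0) // mulrCA ler_piMr ?(ltW e0) //.
    by rewrite ler_pdivrMr // mul1r ler_nat.
  move=> zZ; apply/eqP; rewrite eq_le.
  have H z' (h : z' \in Z) := reached_normal r0 Asup nu1 (reachZ _ h).
  by rewrite H //= -oppr_le0 -dotNl -linearN H // memvN.
pose L : {linear 'rV[R]_n -> R^o} := (dotl nu : 'rV[R]_n -> R^o) \o 'd psi q.
exists (\row_i L (delta_mx 0 i)); split=> [u|x Ax Ux].
  rewrite dotC dot_row_linear /= /dotl.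
  (* Differentiating this identity at [a] shows that ['d psi q] is a left inverse of ['d phi a]. *)
  have E : \forall x \near a, (psi \o phi) x = x.
    by apply: filterS (open_nbhs_nbhs (conj oU Ua)) => x Ux; exact: psiK.
  have E2 := (near_eq_diff E (differentiable_comp (dphi _ Ua) dpsiq)).2.
  have := etrans (esym (diff_comp_apply u (dphi _ Ua) dpsiq)) (esym (congr1 (@^~ u) E2)).
  by move=> H; exact: (congr1 (fun z => dot z nu) (etrans H (diff_id_apply a u))).
apply/eqP; rewrite -subr_eq0 -dotBl dotC dot_row_linear; apply/eqP.
by apply: psiZ; rewrite memvB // ZA.
Qed.

End chart.

(** * Normal fields and the second fundamental form *)

Section normal_field.
Context {R : realType} {n : nat}.
Implicit Types (A U : set 'rV[R]_n) (a x u v w nu : 'rV[R]_n).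

Lemma c1_dot (V : normedModType R) (F : V -> 'rV[R]_n) w (x : V) :
  c1_at F x -> c1_at (fun y => dot (F y) w) x.
Proof.
move=> [dF cF]; apply: (@c1_at_of _ _ _ _ _ (fun y (v : V) => dot ('d F y v) w)).
- by apply: filterS dF => y dy; exact: (diff_dotl w dy).1.
- by apply: filterS dF => y dy; exact: (diff_dotl w dy).2.
- move=> v; have H := @dotl_continuous _ _ w ('d F x v).
  exact: (continuous_comp (cF v) H).
Qed.

Lemma diff_row (V : normedModType R) (g : 'I_n -> V -> R) (x v : V) :
  (forall i, differentiable (g i) x) ->
  'd (fun y => \row_i g i y) x v = \row_i 'd (g i) x v.
Proof.
move=> dg; apply/rowP => i; rewrite mxE -dot_delta.
rewrite -(diff_dotl (delta_mx 0 i) (differentiable_row dg)).2.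
have -> // : (fun y => dot (\row_j g j y) (delta_mx 0 i)) = g i.
by apply/funext => y; rewrite dot_delta mxE.
Qed.

Lemma continuous_row (V : normedModType R) (g : 'I_n -> V -> R) (x : V) :
  (forall i, {for x, continuous (g i)}) ->
  {for x, continuous (fun y => \row_i g i y : 'rV[R]_n)}.
Proof.
move=> cg; rewrite row_sumE.
elim/big_ind: _ => [|f1 f2 c1 c2|i _]; first exact: cst_continuous.
  exact: (continuousD c1 c2).
by apply: cvgZr_tmp; exact: cg.
Qed.

Lemma class1_row (g : 'I_n -> 'rV[R]_n -> R) :
  (forall i x, c1_at (g i) x) -> class_on 1 setT (fun y => \row_i g i y).
Proof.
move=> cg; have dg x i : differentiable (g i) x by exact: nbhs_singleton (cg i x).1.
split=> [x _|v x _]; first exact: differentiable_row.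
have -> : (fun y => 'd (fun y => \row_i g i y) y v) = (fun y => \row_i 'd (g i) y v).
  by apply/funext => y; rewrite diff_row.
by apply: continuous_row => i; exact: (cg i x).2.
Qed.

(** Applied where the cutoff is 1 and the other factor vanishes: the derivative of the cutoff drops
    out. *)
Lemma diffM_unit (V : normedModType R) (f g : V -> R) (x y : V) :
  differentiable f x -> differentiable g x -> f x = 1 -> g x = 0 ->
  'd (fun z => f z * g z) x y = 'd g x y.
Proof. by move=> df dg fx gx; rewrite diffM_ext // fx gx mul1r mul0r addr0. Qed.

(** The field is the gradient of [dot (phi x) w] times a cutoff supported in [U]. It is normal
    because that function is constant on [A] within [U]. *)
Lemma normal_field A a U phi w :
  open U -> U a -> class_on 2 U phi ->
  (forall x y, A x -> A y -> U x -> U y -> dot (phi x) w = dot (phi y) w) ->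
  exists g, [/\ class_on 1 setT g, forall x, A x -> Nor A x (g x),
    forall u, dot (g a) u = dot ('d phi a u) w &
    forall v, dot ('d phi a v) w = 0 -> dot ('d g a v) v = dot (D2 phi a v v) w].
Proof.
move=> oU Ua [dphi c2phi] phiA.
have /nbhs_ballP[rho /= rho0 rhoU] := open_nbhs_nbhs (conj oU Ua).
have rho20 : 0 < rho / 2 by rewrite divr_gt0.
have [chi [chia c1chi chi0 chi00]] := c1_cutoff a rho20.
have inU x : enorm (x - a) <= rho / 2 -> U x.
  move=> h; apply: rhoU; rewrite -ball_normE /= distrC.
  by rewrite (le_lt_trans (norm_le_enorm _)) // (le_lt_trans h) //; lra.
have nearU x : U x -> \forall y \near x, U y.
  by move=> Ux; exact: open_nbhs_nbhs.
have c1phi x u : U x -> c1_at (fun y => 'd phi y u) x.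
  move=> Ux; have [du cu] := c2phi u; split; last by move=> v; exact: cu.
  by apply: filterS (nearU _ Ux) => y; exact: du.
pose G i x := dot ('d phi x (delta_mx 0 i)) w.
pose g x := \row_i (chi x * G i x).
have gE x u : dot (g x) u = chi x * dot ('d phi x u) w.
  pose L : {linear 'rV[R]_n -> R^o} := (dotl w : 'rV[R]_n -> R^o) \o 'd phi x.
  have -> : g x = chi x *: \row_i L (delta_mx 0 i).
    by apply/rowP => i; rewrite !mxE.
  by rewrite dotZl dot_row_linear.
(* On the closed ball of radius [rho / 2] the chart is available; outside it [chi] vanishes near
   [x], whatever the values of ['d phi] are there. *)
have cg i x : c1_at (fun y => chi y * G i y) x.
  have [h|h] := lerP (enorm (x - a)) (rho / 2).
    by apply: c1M => //; apply: c1_dot; apply: c1phi; exact: inU.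
  apply: near_eq_c1 (c1_cst 0 x).
  by apply: filterS (chi00 _ h) => y ->; rewrite mul0r.
have c1g : class_on 1 setT g by exact: class1_row.
exists g; split=> //.
- move=> x Ax u Tu; rewrite gE.
  have [h|h] := lerP (enorm (x - a)) (rho / 2); last by rewrite chi0 ?mul0r // ltW.
  have Ux := inU _ h.
  have [df Ef] := diff_dotl w (dphi x Ux).
  rewrite -Ef (reached_diff_eq0 df _ (Tan_reached Tu)) ?mulr0 //.
  by apply: filterS (nearU _ Ux) => y Uy Ay; exact: phiA.
- by move=> u; rewrite gE chia mul1r.
- move=> v v0.
  apply: (etrans (esym ((diff_dotl v (c1g.1 a I)).2 v))).
  (* Pairing with the fixed [v] gives a product of scalar functions, to which [diffM_unit]
     applies. *)
  have gv : (fun y => dot (g y) v) = (fun y => chi y * dot ('d phi y v) w).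
    by apply/funext => y; rewrite gE.
  apply: (etrans (congr1 (fun F : 'rV[R]_n -> R => 'd F a v) gv)).
  have dv : differentiable (fun y => 'd phi y v) a by exact: (c2phi v).1.
  have [dvw Evw] := diff_dotl w dv.
  have dchi : differentiable chi a by exact: nbhs_singleton (c1chi a).1.
  exact: (etrans (diffM_unit v dchi dvw chia v0) (Evw v)).
Qed.

(** As [dot (phi x) w] is constant on [A] near [a], its Taylor expansion equates [dot (y - a) nu]
    with [- (t ^+ 2 / 2 * B)] up to [e * t ^+ 2], and the normal field identifies [- B] with
    [dot (b v v) nu]. *)
Lemma submanifold_second_order A a nu (r : R) m b :
  0 < r -> enorm nu = 1 -> supported A a nu r ->
  submanifold 2 m A -> A a -> second_fundamental_form A a b ->
  forall v, Tan A a v -> dot (b v v) nu <= r^-1 * enorm v ^+ 2.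
Proof.
move=> r0 nu1 Asup Amfd Aa [_ _ _ Hb] v Tv.
have [U [phi [psi [Z [[oU Ua] cphi [oV cpsi] psiK [_ AZ]]]]]] := Amfd a Aa.
have [w [wnu wA]] := chart_conormal r0 nu1 Asup Aa oU Ua cphi.1 oV cpsi.1 psiK AZ.
have wA2 x y : A x -> A y -> U x -> U y -> dot (phi x) w = dot (phi y) w.
  by move=> Ax Ay Ux Uy; rewrite !wA.
have [g [c1g Ng ga Dg]] := normal_field oU Ua cphi wA2.
have gnu : g a = nu.
  by apply/rowP => i; rewrite -2!dot_delta ga wnu dotC.
have vnu : dot v nu = 0 by rewrite dotC -gnu; exact: Ng.
(* The cutoff makes the field of class 1 on the whole space. *)
have {}Hb := Hb setT g openT (@subsetT _ _) c1g Ng v v Tv Tv.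
rewrite gnu Dg in Hb; last by rewrite wnu.
rewrite Hb; have [B EB] : exists B, B = dot (D2 phi a v v) w by exists (dot (D2 phi a v v) w).
have [dphi c2phi] := cphi.
have nU : \forall x \near a, U x by exact: open_nbhs_nbhs.
have dphi_near : \forall x \near a, differentiable phi x by apply: filterS nU => x; exact: dphi.
have dphi2 u : differentiable (fun x => 'd phi x u) a by exact: (c2phi u).1.
have taylor (e : R) : 0 < e -> exists2 d, 0 < d & forall t h, 0 < t < d ->
    `|h - t *: v| <= d * t ->
    dot (phi (a + h)) w = dot (phi a) w ->
    - (t ^+ 2 / 2 * B) <= dot h nu + e * t ^+ 2.
  move=> e0; have [d d0 H] := taylor2_dotl w v dphi_near dphi2 e0.
  exists d => // t h td hd E; have := H t h td hd.
  rewrite E subrr sub0r wnu -EB ler_norml => /andP[]; lra.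
have /nbhs_ballP[rho /= rho0 rhoU] := nU.
(* The summand 2 is twice the Taylor error. *)
rewrite -EB; apply: (@le_eps _ _ _ (r^-1 * (2 * enorm v + 1) + 2)) => e e0 e1.
have [d d0 H] := taylor e e0.
have v1 : 0 < enorm v + 1 by rewrite ltr_wpDl ?enorm_ge0.
pose e' := Num.min e (Num.min d (rho / (enorm v + 1))).
have e'0 : 0 < e' by rewrite !lt_min e0 d0 divr_gt0.
have [l1 [l2 l3]] : e' <= e /\ e' <= d /\ e' <= rho / (enorm v + 1).
  by rewrite /e' !ge_min !lexx !orbT.
have [t [y [/andP[t0 te] Ay yt]]] := Tan_reached Tv e'0.
have yt' : enorm (y - a - t *: v) <= e * t.
  by rewrite (le_trans yt) // ler_wpM2r // ltW.
have Uy : U y.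
  apply: rhoU; rewrite -ball_normE /= distrC.
  rewrite (le_lt_trans (norm_le_enorm _)) // -(subrK (t *: v) (y - a)).
  rewrite (le_lt_trans (enormD _ _)) // enormZ gtr0_norm //.
  apply: (@le_lt_trans _ _ (t * (enorm v + 1))).
    rewrite mulrDr mulr1 addrC lerD2l (le_trans yt') // -[leRHS]mul1r ler_wpM2r //.
    exact: ltW.
  by rewrite -ltr_pdivlMr // (lt_le_trans te).
have := H t (y - a); rewrite t0 (lt_le_trans te l2) => /(_ isT).
have hd : `|y - a - t *: v| <= d * t.
  by rewrite (le_trans (norm_le_enorm _)) // (le_trans yt) // ler_wpM2r // ltW.
rewrite [a + _]addrC subrK => /(_ hd (wA _ Ay Uy)) {}H.
have Hs := supported_le r0 Asup t0 e0 e1 Ay yt'.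
have t20 : 0 < t ^+ 2 by rewrite exprn_gt0.
by rewrite -(ler_pM2l t20); move: (dot (y - a) nu) Hs H => x; lra.
Qed.

End normal_field.

(** * Hausdorff measure and approximate differentiability *)

Section hausdorff_measure.
Context {R : realType}.

Lemma alpha_ge0 m : 0 <= alpha m :> R.
Proof.
apply: fine_ge0; apply: le_ereal_inf_tmp => _ [D [p [q [pq _ ->]]]].
apply: esum_ge0 => j _; rewrite lee_fin; apply: prodr_ge0 => i _.
by rewrite subr_ge0.
Qed.

Lemma le_esum_scale (T : choiceType) (D : set T) (c : R) (a b : T -> \bar R) :
  0 <= c -> (forall i, 0 <= a i)%E -> (forall i, D i -> b i <= c%:E * a i)%E ->
  (\esum_(i in D) b i <= c%:E * \esum_(i in D) a i)%E.
Proof.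
move=> c0 a0 ba; apply: ge_ereal_sup => _ [F [Ff FD] <-].
apply: (@le_trans _ _ (\sum_(i \in F) (c%:E * a i))%E).
  by apply: lee_fsum => // i Fi; apply: ba; exact: FD.
rewrite -ge0_mule_fsumr //; apply: lee_wpmul2l; rewrite ?lee_fin //.
by apply: ereal_sup_ubound; exists F.
Qed.

Context {n : nat}.
Implicit Types B : set 'rV[R]_n.

Lemma ediam_ge0 B : (0 <= ediam B)%E.
Proof. by apply: ereal_sup_ubound; left. Qed.

Lemma hausdorff_pre_le m (d : R) B B' : B `<=` B' ->
  (hausdorff_pre m d B <= hausdorff_pre m d B')%E.
Proof.
move=> BB'; apply: le_ereal_inf_tmp => _ [D [G [BG Gd ->]]].
by apply: ereal_inf_lbound; exists D, G; split=> //; exact: subset_trans BG.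
Qed.

Lemma hausdorff_pre_le_diam m (d d' : R) B : d <= d' ->
  (hausdorff_pre m d' B <= hausdorff_pre m d B)%E.
Proof.
move=> dd'; apply: le_ereal_inf_tmp => _ [D [G [BG Gd ->]]]; apply: ereal_inf_lbound.
exists D, G; split=> // j Dj; rewrite (le_trans (Gd j Dj)) // lee_fin //.
Qed.

Lemma hausdorff_le m B B' : B `<=` B' -> (hausdorff m B <= hausdorff m B')%E.
Proof.
move=> BB'; apply: ge_ereal_sup => _ [d d0 <-].
apply: (le_trans (hausdorff_pre_le m d BB')).
by apply: ereal_sup_ubound; exists d.
Qed.

Lemma rat_dense_row (x : 'rV[R]_n) (e : R) : 0 < e ->
  exists q : 'rV[rat]_n, `|x - map_mx ratr q| <= e.
Proof.
move=> e0; have H i : exists q : rat, ratr q \in `]x 0 i - e, x 0 i + e[.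
  by apply: rat_in_itvoo; lra.
exists (\row_i projT1 (cid (H i))).
rewrite -[`|_|]/(mx_norm _) mx_normrE; apply: bigmax_le => [|[i j] _ /=].
  exact: ltW.
rewrite ord1 !mxE; case: (cid (H j)) => q /=; rewrite in_itv /= => /andP[? ?].
by rewrite ler_norml; lra.
Qed.

(** Maximum norm balls about rational points, enumerated by [unpickle]. Hence the infimum in
    [hausdorff_pre] always has an admissible cover. *)
Lemma small_cover (d : R) : 0 < d -> exists G : nat -> set 'rV[R]_n,
  setT `<=` \bigcup_j G j /\ forall j, (ediam (G j) <= d%:E)%E.
Proof.
(* A maximum norm ball of radius [e] has Euclidean diameter at most 2 n e, which is below [d]. *)
move=> d0; pose e := d / 2 / n.+1%:R.
have e0 : 0 < e by rewrite !divr_gt0.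
pose G j : set 'rV[R]_n := if unpickle j is Some q then
  [set x | `|x - map_mx ratr (q : 'rV[rat]_n)| <= e] else set0.
exists G; split=> [x _|j].
  have [q qe] := rat_dense_row x e0.
  by exists (pickle q) => //; rewrite /G pickleK.
apply: ge_ereal_sup => _ [->|[x [y [Gx Gy ->]]]]; first by rewrite lee_fin ltW.
move: Gx Gy; rewrite /G; case: (unpickle j) => [q|] //= xq yq.
rewrite lee_fin (le_trans (enorm_le_norm _)) //.
have xy : `|x - y| <= e + e.
  by rewrite -(subrKA (map_mx ratr q)) (le_trans (ler_normD _ _)) // lerD // distrC.
apply: (@le_trans _ _ (n.+1%:R * (e + e))).
  by rewrite ler_pM // ler_nat.
by rewrite [leLHS](_ : _ = d) // /e; field; rewrite ?gt_eqF.
Qed.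

(** Every set of a cover has weight 0, and [small_cover] provides a cover. *)
Lemma hausdorff_alpha0 m B : alpha m = 0 :> R -> (hausdorff m B <= 0)%E.
Proof.
move=> am; apply: ge_ereal_sup => _ [d d0 <-].
have [G [GT Gd]] := small_cover d0.
apply: ereal_inf_lbound; exists setT, G; split=> //.
  exact: subset_trans (@subsetT _ _) GT.
by rewrite esum1 // => j _; rewrite am mul0r mul0e.
Qed.

(** For a diameter at most [d' <= 1], its power [m + k.+1] is at most [d'] times its power [m], so
    the covering sums shrink with [d']. Positivity of [alpha m] permits division by the weight
    [c']. *)
Lemma hausdorff_null m k B : 0 < alpha m :> R -> (hausdorff m B < +oo)%E ->
  (hausdorff (m + k.+1) B <= 0)%E.
Proof.
move=> am Bfin.
have [K K0 BK] : exists2 K : R, 0 < K & (hausdorff m B < K%:E)%E.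
  case: (hausdorff m B) Bfin => [x _|//|_].
    by exists (`|x| + 1); rewrite ?ltr_wpDl // lte_fin (le_lt_trans (ler_norm _)) // ltrDl.
  by exists 1 => //; rewrite ltNyr.
pose c : R := alpha (m + k.+1) / 2 ^+ (m + k.+1).
pose c' : R := alpha m / 2 ^+ m.
have c0 : 0 <= c by rewrite divr_ge0 ?alpha_ge0 // exprn_ge0.
have c'0 : 0 < c' by rewrite divr_gt0 // exprn_gt0.
apply/lee_addgt0Pr => e e0; rewrite add0e.
apply: ge_ereal_sup => _ [d d0 <-].
(* The last bound makes [c / c' * d' * K] at most [e]. *)
pose d' := Num.min 1 (Num.min d (e / (c / c' * K + 1))).
have cK : 0 < c / c' * K + 1.
  by rewrite ltr_wpDl // mulr_ge0 ?(ltW K0) // divr_ge0 // ltW.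
have d'0 : 0 < d' by rewrite !lt_min ltr01 d0 divr_gt0.
have [l1 [l2 l3]] : d' <= 1 /\ d' <= d /\ d' <= e / (c / c' * K + 1).
  by rewrite /d' !ge_min !lexx !orbT.
apply: (le_trans (hausdorff_pre_le_diam _ _ l2)).
have : (hausdorff_pre m d' B < K%:E)%E.
  by apply: le_lt_trans BK; apply: ereal_sup_ubound; exists d'.
move=> /ereal_inf_lt[_ [D [G [BG Gd ->]]] VK].
have dc0 : 0 <= c / c' * d' by rewrite mulr_ge0 ?(ltW d'0) // divr_ge0 // ltW.
apply: (@le_trans _ _ ((c / c' * d')%:E *
    \esum_(j in D) ((alpha m / 2 ^+ m)%:E * ediam (G j) ^+ m))%E).
  apply: (@le_trans _ _ (\esum_(j in D) (c%:E * ediam (G j) ^+ (m + k.+1))%E)).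
    by apply: ereal_inf_lbound; exists D, G.
  apply: le_esum_scale => // [j|j Dj].
    by apply: mule_ge0; [rewrite lee_fin ltW | rewrite expe_ge0 // ediam_ge0].
  have := Gd j Dj; have := ediam_ge0 (G j).
  case: (ediam (G j)) => [x|//|//]; rewrite !lee_fin => x0 xd.
  rewrite -!EFin_expe -!EFinM lee_fin -/c'.
  have -> : c / c' * d' * (c' * x ^+ m) = c * (x ^+ m * d').
    by field; rewrite gt_eqF.
  rewrite ler_wpM2l // exprD ler_wpM2l ?exprn_ge0 // exprS.
  rewrite (le_trans _ xd) // ler_piMr // exprn_ile1 //.
  exact: le_trans l1.
apply: (@le_trans _ _ ((c / c' * d')%:E * K%:E)%E).
  by apply: lee_wpmul2l; rewrite ?lee_fin // ltW.
rewrite -EFinM lee_fin mulrAC (le_trans (ler_wpM2l _ l3)) //.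
  by rewrite mulr_ge0 ?(ltW K0) // divr_ge0 // ltW.
rewrite mulrA ler_pdivrMr // mulrC ler_wpM2l ?(ltW e0) //.
by rewrite lerDl.
Qed.

End hausdorff_measure.

(** * Twofold differentiability of polynomial maps *)

Section twice_differentiable.
Context {R : realType} {V : normedModType R}.

Definition twice_diff (W : normedModType R) (f : V -> W) :=
  (forall x, differentiable f x) /\
  (forall u x, differentiable (fun y => 'd f y u) x).

Lemma twice_diff_of (W : normedModType R) (f : V -> W) (D : V -> V -> W) :
  (forall x, differentiable f x) -> (forall x u, 'd f x u = D x u) ->
  (forall u x, differentiable (fun y => D y u) x) -> twice_diff f.
Proof.
move=> df fD dD; split=> // u x.
by have -> : (fun y => 'd f y u) = (fun y => D y u) by apply/funext => y.
Qed.

Lemma twice_diff_cst (W : normedModType R) (c : W) : twice_diff (fun=> c).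
Proof.
apply: (@twice_diff_of _ _ (fun _ _ => 0)) => [x|x u|u x].
- exact: differentiable_cst.
- by have := @diff_cst _ V W c x; rewrite /cst => ->.
- exact: differentiable_cst.
Qed.

Lemma twice_diffD (W : normedModType R) (f g : V -> W) :
  twice_diff f -> twice_diff g -> twice_diff (f + g).
Proof.
move=> [df df2] [dg dg2].
apply: (@twice_diff_of _ _ (fun x u => 'd f x u + 'd g x u)) => [x|x u|u x].
- exact: differentiableD.
- by rewrite diffD.
- exact: (differentiableD (df2 u x) (dg2 u x)).
Qed.

Lemma twice_diff_sum (W : normedModType R) (I : finType) (P : pred I) (f : I -> V -> W) :
  (forall i, P i -> twice_diff (f i)) -> twice_diff (fun x => \sum_(i | P i) f i x).
Proof.
move=> df; have -> : (fun x => \sum_(i | P i) f i x) = \sum_(i | P i) f i.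
  by apply/funext => x; rewrite fct_sumE.
elim/big_ind: _ => //; first exact: twice_diff_cst.
exact: twice_diffD.
Qed.

Lemma twice_diffM (f g : V -> R) :
  twice_diff f -> twice_diff g -> twice_diff (fun x => f x * g x).
Proof.
move=> [df df2] [dg dg2].
apply: (@twice_diff_of _ _ (fun x u => f x * 'd g x u + g x * 'd f x u)) => [x|x u|u x].
- exact: differentiableM.
- exact: diffM_ext.
- apply: differentiableD; first exact: (differentiableM (df x) (dg2 u x)).
  exact: (differentiableM (dg x) (df2 u x)).
Qed.

Lemma twice_diffX (f : V -> R) k : twice_diff f -> twice_diff (fun x => f x ^+ k).
Proof.
move=> df; elim: k => [|k IH]; first exact: twice_diff_cst.
have -> : (fun x => f x ^+ k.+1) = (fun x => f x * f x ^+ k).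
  by apply/funext => x; rewrite exprS.
exact: twice_diffM.
Qed.

Lemma twice_diff_prod (I : finType) (f : I -> V -> R) :
  (forall i, twice_diff (f i)) -> twice_diff (fun x => \prod_i f i x).
Proof.
move=> df; elim: (index_enum I) => [|i s IH].
  have -> : (fun x => \prod_(i <- [::]) f i x) = fun=> 1.
    by apply/funext => x; rewrite big_nil.
  exact: twice_diff_cst.
have -> : (fun x => \prod_(j <- i :: s) f j x) = fun x => f i x * \prod_(j <- s) f j x.
  by apply/funext => x; rewrite big_cons.
exact: twice_diffM.
Qed.

Lemma twice_diffZl (W : normedModType R) (f : V -> R) (c : W) :
  twice_diff f -> twice_diff (fun x => f x *: c).
Proof.
move=> [df df2].
apply: (@twice_diff_of _ _ (fun x u => 'd f x u *: c)) => [x|x u|u x].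
- exact: differentiableZl.
- by have := @diffZl _ _ _ f c x (df x) => ->.
- exact: differentiableZl.
Qed.

End twice_differentiable.

Section polynomials.
Context {R : realType} {n : nat}.

Lemma twice_diff_linear (L : {linear 'rV[R]_n -> R^o}) : twice_diff (L : 'rV[R]_n -> R).
Proof.
pose w := \row_i L (delta_mx 0 i).
have -> : (L : 'rV[R]_n -> R) = (fun x => dot x w).
  by apply/funext => x; rewrite dotC dot_row_linear.
apply: (@twice_diff_of _ _ _ _ (fun _ u => dot u w)) => [x|x u|u x].
- exact/(linear_differentiable (f := dotl w))/dotl_continuous.
- have -> : (fun z => dot z w) = (dotl w : 'rV[R]_n -> R^o) by [].
  by rewrite diff_lin //; exact: dotl_continuous.
- exact: differentiable_cst.
Qed.

(** As [oproj T x] lies in [T], where [P] has its monomial formula, the composition is a polynomial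
    in the linear forms [oproj T x 0 i]. *)
Lemma twice_diff_poly k (T : {vspace 'rV[R]_n}) (P : 'rV[R]_n -> 'rV[R]_n) :
  poly_on k T P -> twice_diff (P \o oproj T).
Proof.
move=> [c Pc].
have -> : P \o oproj T = (fun x => \sum_(al : {ffun 'I_n -> 'I_k.+1} | (\sum_i al i <= k)%N)
            (\prod_i oproj T x 0 i ^+ al i) *: c al).
  by apply/funext => x; rewrite /= Pc //; exact: (oprojP T x).1.
apply: twice_diff_sum => al _; apply: twice_diffZl.
apply: twice_diff_prod => i; apply: twice_diffX.
pose L : {linear 'rV[R]_n -> R^o} :=
  (dotl (delta_mx 0 i) : 'rV[R]_n -> R^o) \o (daddv_pi T (orthv T) : {linear _ -> _}).
have -> : (fun x => oproj T x 0 i) = L by apply/funext => x; rewrite /= /dotl dot_delta.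
exact: twice_diff_linear.
Qed.

End polynomials.

Section orthogonal.
Context {R : realType} {n : nat}.
Implicit Types (T : {vspace 'rV[R]_n}) (x : 'rV[R]_n).

Lemma oproj_orthv T x : oproj (orthv T) x = x - oproj T x.
Proof.
have [pT qT] := oprojP T x.
rewrite -{1}(subrK (oproj T x) x) oproj_add //.
by apply/memv_orthv => u /memv_orthv/(_ _ pT); rewrite dotC.
Qed.

Lemma cylinder_enorm T x (s : R) y : cylinder T x s s y -> enorm (y - x) <= 2 * s.
Proof.
move=> []; rewrite oproj_orthv => h1 h2.
rewrite -(subrK (oproj T (y - x)) (y - x)) (le_trans (enormD _ _)) //; lra.
Qed.

(** Subspaces are closed: the component of [v] orthogonal to [T] is at most the distance from [v] to
    any point of [T]. *)
Lemma mem_of_near T v (C : R) :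
  (forall e, 0 < e -> e <= 1 -> exists2 z, z \in T & enorm (v - z) <= C * e) -> v \in T.
Proof.
move=> H; have [qT rT] := oprojP T v.
suff /eqP : enorm (v - oproj T v) = 0 by rewrite enorm_eq0 subr_eq0 => /eqP ->.
apply/eqP; rewrite eq_le enorm_ge0 andbT.
apply: (@le_eps _ _ _ C) => e e0 e1; have [z zT vz] := H e e0 e1.
rewrite add0r (le_trans _ vz) //.
have -> : v - z = (oproj T v - z) + (v - oproj T v).
  by rewrite [RHS]addrC subrKA.
by apply: (@enorm_le_addl _ _ T) => //; rewrite memvB.
Qed.

End orthogonal.

(** * Approximate tangent spaces and the approximate second order bound *)

Section approximate_case.
Context {R : realType} {n : nat}.
Variables (A : set 'rV[R]_n) (a : 'rV[R]_n).
Implicit Types (T : {vspace 'rV[R]_n}) (P : 'rV[R]_n -> 'rV[R]_n).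

Let A1 := [set x - a | x in A].

(* If alpha m = 0, the quotient in (ii) is the junk value 0, but the Hausdorff
   measure vanishes, contradicting (i). *)
Lemma ap_alpha_gt0 k m T P : ap_approx k m A a T P -> 0 < alpha m :> R.
Proof.
move=> [_ _ /(_ 1 ltr01)[rho [eta [rho0 eta0 H]]] _].
rewrite lt_def alpha_ge0 andbT; apply/eqP => am.
have := H rho 0; rewrite ltW //= lexx mem0v /ecball /= subr0 enorm0 ltW //.
move=> /(_ isT isT isT) /le_trans /(_ (hausdorff_alpha0 _ am)).
by rewrite lee_fin leNgt mulr_gt0 // exprn_gt0.
Qed.

(* If all points of A1 in the cylinder were far from the graph of P', then (ii)
   for T' would contradict (i) for T: directly if m = m', and if m' < m because
   a set of finite m'-dimensional measure is m-dimensionally null. *)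
Lemma ap_points k m T P k' m' T' P' v (e : R) :
  ap_approx k m A a T P -> ap_approx k' m' A a T' P' -> (m' <= m)%N ->
  v \in T -> 0 < e -> exists2 d, 0 < d & forall t, 0 < t < d ->
  exists y z, [/\ A1 y, z \in T', enorm (y - t *: v) <= e * t &
    enorm (y - (z + P' z)) <= e * t ^+ k'].
Proof.
move=> [_ _ Hi _] ap' mm' vT e0.
have am' := ap_alpha_gt0 ap'; have [_ _ _ Hii] := ap'.
pose c := enorm v + 1.
have c0 : 0 < c by rewrite ltr_wpDl ?enorm_ge0.
(* With [r = c * t], the first bound puts the cylinder about [t *: v] into the ball of radius
   [2 * r], the second puts it within [e * t] of [t *: v]. *)
pose eps := Num.min (1 / 2) (e / (2 * c)).
have eps0 : 0 < eps by rewrite lt_min !divr_gt0 // mulr_gt0.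
have [epsl1 epsl2] : eps <= 1 / 2 /\ eps <= e / (2 * c).
  by rewrite /eps !ge_min !lexx !orbT.
have [rho [eta [rho0 eta0 {}Hi]]] := Hi eps eps0.
(* Then [eps' * (2 * r) ^+ k'] is [e / 2 * t ^+ k']; the factor 1/2 yields the strict inequality
   needed to pick a graph point. *)
pose eps' := e / 2 / (2 * c) ^+ k'.
have eps'0 : 0 < eps' by rewrite !divr_gt0 // exprn_gt0 // mulr_gt0.
(* With this threshold, (ii) at radius [2 * r] bounds the measure of the bad set by exactly
   [eta * r ^+ m']. *)
have kap0 : 0 < eta / (alpha m' * 2 ^+ m').
  by rewrite divr_gt0 // mulr_gt0 // exprn_gt0.
have [d d0 Hd] := cvg_right0_lt (Hii eps' eps'0) kap0.
exists (Num.min (rho / c) (d / (2 * c))).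
  by rewrite lt_min !divr_gt0 // mulr_gt0.
move=> t /andP[t0]; rewrite lt_min => /andP[trho td].
pose r := c * t.
have r0 : 0 < r by rewrite mulr_gt0.
have rrho : r <= rho by rewrite /r mulrC -ler_pdivlMr // ltW.
have rd : 2 * r < d by rewrite /r mulrA mulrC -ltr_pdivlMr // mulr_gt0.
have vr : ecball 0 r (t *: v).
  rewrite /ecball /= subr0 enormZ gtr0_norm // /r mulrC ler_wpM2r ?(ltW t0) //.
  by rewrite /c lerDl.
have tvT : t *: v \in T by rewrite memvZ.
have r01 : 0 <= r <= rho by rewrite (ltW r0).
have {}Hi := Hi r (t *: v) r01 tvT vr.
set cyl := cylinder _ _ _ _ in Hi.
have cyle y : cyl y -> enorm (y - t *: v) <= e * t.
  move=> /cylinder_enorm /le_trans; apply; rewrite /r mulrA mulrA.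
  rewrite ler_wpM2r ?(ltW t0) //.
  move: epsl2; rewrite ler_pdivlMr ?mulr_gt0 //; nra.
have cylr y : cyl y -> ecball 0 (2 * r) y.
  move=> /cylinder_enorm h; rewrite /ecball /= subr0 -(subrK (t *: v) y).
  rewrite (le_trans (enormD _ _)) //.
  move: vr; rewrite /ecball /= subr0 => vr.
  have : eps * r <= 1 / 2 * r by rewrite ler_wpM2r // ltW.
  lra.
have [/= [y [cy Ay] yP]|none] := pselect (exists2 y, (cyl `&` A1) y &
    (Defs.edist (graph T' P') y <= (eps' * (2 * r) ^+ k')%:E)%E).
  have /edist_lt[_ [z zT' <-] yz] : (Defs.edist (graph T' P') y < (e * t ^+ k')%:E)%E.
    apply: (le_lt_trans yP); rewrite lte_fin.
    have -> : eps' * (2 * r) ^+ k' = e / 2 * t ^+ k'.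
      have c2 : (2 * c) ^+ k' != 0 by rewrite expf_neq0 // gt_eqF // mulr_gt0.
      rewrite (_ : 2 * r = 2 * c * t); last by rewrite /r mulrA.
      by rewrite exprMn /eps' mulrA divfK.
    rewrite ltr_pM2r ?exprn_gt0 //; lra.
  by exists y, z; split=> //; [exact: cyle | exact: ltW].
exfalso.
have r20 : 0 < 2 * r by rewrite mulr_gt0.
pose bad := A1 `&` ecball 0 (2 * r) `&`
  [set z | ((eps' * (2 * r) ^+ k')%:E < Defs.edist (graph T' P') z)%E].
have sub : cyl `&` A1 `<=` bad.
  move=> y [cy Ay]; split; first by split=> //; exact: cylr.
  by rewrite /= ltNge; apply/negP => h; apply: none; exists y.
have := le_trans Hi (hausdorff_le m sub).
have := Hd (2 * r); rewrite r20 rd => /(_ isT); rewrite -/A1 -/bad.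
have am'r : 0 < alpha m' * (2 * r) ^+ m' by rewrite mulr_gt0 // exprn_gt0.
rewrite lte_pdivrMr // -EFinM.
have [j ->] : exists j, m = (m' + j)%N by exists (m - m')%N; rewrite subnKC.
have etar (i : nat) : 0 < eta * r ^+ i by rewrite mulr_gt0 // exprn_gt0.
case: j => [|j] Hbad.
  rewrite addn0 => /le_lt_trans/(_ Hbad).
  have -> : eta / (alpha m' * 2 ^+ m') * (alpha m' * (2 * r) ^+ m') = eta * r ^+ m'.
    by rewrite exprMn; field; rewrite expf_neq0 // gt_eqF.
  by rewrite ltxx.
have bfin : (hausdorff m' bad < +oo)%E by rewrite (lt_trans Hbad) // ltry.
move=> /le_trans/(_ (hausdorff_null j am' bfin)).
by rewrite lee_fin leNgt etar.
Qed.

(** The points of [ap_points] are close to both [t *: v] and [z + P' z] with [z] in [T']. As [P']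
    vanishes to first order at 0, [t^-1 *: z] tends to [v], and [T'] is closed. *)
Lemma ap_sub k m T P k' m' T' P' :
  ap_approx k m A a T P -> ap_approx k' m' A a T' P' -> (1 <= k')%N -> (m' <= m)%N ->
  (T <= T')%VS.
Proof.
move=> ap ap' k'1 mm'; apply/subvP => v vT.
have [_ [P'T P'poly P'0 dP'] _ _] := ap'.
have v0 := enorm_ge0 v.
(* The 2 counts the two errors at [y]; the other summand bounds [P' z], using |z| <= t (|v| + 2). *)
apply: (@mem_of_near _ _ _ _ (2 + n%:R * (enorm v + 2))) => e e0 e1.
have [d1 d10 H1] := ap_points ap ap' mm' vT e0.
have [d2 d20 H2] := differentiable_near ((twice_diff_poly P'poly).1 0) e0.
have C0 : 0 < enorm v + 2 by lra.
pose t := Num.min 1 (Num.min (d1 / 2) (d2 / 2 / (enorm v + 2))).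
have t0 : 0 < t by rewrite !lt_min ltr01 !divr_gt0.
have [l1 [l2 l3]] : t <= 1 /\ t <= d1 / 2 /\ t <= d2 / 2 / (enorm v + 2).
  by rewrite /t !ge_min !lexx !orbT.
have [|y [z [_ zT' yt yz]]] := H1 t; first by rewrite t0; lra.
(* Here [1 <= k'] and [t <= 1] are used. *)
have {}yz : enorm (y - (z + P' z)) <= e * t.
  rewrite (le_trans yz) // ler_wpM2l ?(ltW e0) //.
  by case: (k') k'1 => // i _; rewrite exprS ler_piMr ?(ltW t0) // exprn_ile1 // ltW.
have zt : enorm z <= t * (enorm v + 2).
  rewrite (le_trans (enorm_le_addr zT' (P'T _ zT'))) //.
  have -> : z + P' z = (y - t *: v) - (y - (z + P' z)) + t *: v.
    by apply/rowP => i; rewrite !mxE; ring.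
  rewrite (le_trans (enormD _ _)) // enormZ gtr0_norm //.
  have := enormB (y - t *: v) (y - (z + P' z)).
  have : e * t <= 1 * t by rewrite ler_wpM2r // ltW.
  lra.
have P'z : enorm (P' z) <= n%:R * e * (t * (enorm v + 2)).
  have zd : `|z| < d2.
    rewrite (le_lt_trans (norm_le_enorm _)) // (le_lt_trans zt) //.
    rewrite -ltr_pdivlMr // (le_lt_trans l3) // ltr_pM2r ?invr_gt0 //; lra.
  have := H2 z zd; rewrite dP' subr0 /= add0r.
  have o0 : oproj T' 0 = 0 by rewrite /oproj linear0.
  rewrite o0 P'0 subr0 oproj_id // => h.
  rewrite (le_trans (enorm_le_norm _)) // -mulrA ler_wpM2l // (le_trans h) //.
  by rewrite ler_wpM2l ?(ltW e0) // (le_trans (norm_le_enorm _)).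
exists (t^-1 *: z); first by rewrite memvZ.
have -> : v - t^-1 *: z = t^-1 *: (t *: v - z).
  by rewrite scalerBr scalerA mulVf ?scale1r // gt_eqF.
rewrite enormZ gtr0_norm ?invr_gt0 // ler_pdivrMl //.
have -> : t *: v - z = (y - (z + P' z)) - (y - t *: v) + P' z.
  by apply/rowP => i; rewrite !mxE; ring.
rewrite (le_trans (enormD _ _)) //.
have := enormB (y - (z + P' z)) (y - t *: v).
by lra.
Qed.

(** [ap_sub] applies directly if [m' <= m]. Otherwise it gives the reverse inclusion, whose
    dimensions contradict [m < m']. *)
Lemma ap_unique k m T P k' m' T' P' : (1 <= k)%N -> (1 <= k')%N ->
  ap_approx k m A a T P -> ap_approx k' m' A a T' P' -> (T <= T')%VS.
Proof.
move=> k1 k'1 ap ap'; have [mm'|mm'] := leqP m' m; first exact: ap_sub ap ap' k'1 mm'.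
have := dimvS (ap_sub ap' ap k1 (ltnW mm')).
have [[_ ->] _ _ _] := ap; have [[_ ->] _ _ _] := ap'.
by rewrite leqNgt mm'.
Qed.

(** The tangent space and the differential come with possibly different approximations, which
    [ap_unique] reconciles. Then [ap_points], comparing one approximation of order 2 with itself,
    supplies the points for [graph_second_order] at the origin. *)
Lemma approximate_second_order nu (r : R) T D :
  0 < r -> enorm nu = 1 -> supported A a nu r ->
  is_apTan A a T -> is_apD2 A a D ->
  forall v, v \in T -> dot (D v v) nu <= r^-1 * enorm v ^+ 2.
Proof.
move=> r0 nu1 Asup [k [m [P0 [k1 ap0]]]] [T' [P [_ ap ->]]] v vT.
have {}vT : v \in T' by apply: subvP vT; exact: ap_unique ap0 ap.
have [_ [PT Ppoly P00 _] _ _] := ap.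
have [dP dP2] := twice_diff_poly Ppoly.
have A1sup : supported A1 0 nu r.
  by move=> _ [x Ax <-]; rewrite subr0; exact: Asup.
have gP : graph T' P 0 by exists 0; rewrite /= ?mem0v // P00 addr0.
apply: (graph_second_order r0 A1sup nu1 PT gP dP (fun u => dP2 u 0)) => //.
move=> {v vT} v vT e e0; have [d d0 H] := ap_points ap ap (leqnn _) vT e0.
pose t := Num.min (e / 2) (d / 2).
have t0 : 0 < t by rewrite lt_min !divr_gt0.
have [te td] : t <= e / 2 /\ t <= d / 2 by rewrite /t !ge_min !lexx orbT.
have [|y [z [Ay zT yt yz]]] := H t; first by rewrite t0; lra.
by exists t, y, z; split=> //; [rewrite t0; lra | rewrite subr0].
Qed.

End approximate_case.

(** * Second order bounds for sets avoiding a ball *)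

Unset Implicit Arguments.

Theorem theorem4p12 (R : realType) (n : nat) (A : set 'rV[R]_n)
    (a nu : 'rV[R]_n) (r : R) (hnu : enorm nu = 1) (hr : 0 < r)
    (hA : eoball (a + r *: nu) r `&` A = set0) :
  [/\ (forall m : nat, submanifold 2 m A -> A a ->
         forall b, second_fundamental_form A a b ->
         forall v, Tan A a v -> dot (b v v) nu <= r^-1 * enorm v ^+ 2),
      (pt_differentiable2 A a ->
         forall (S : {vspace 'rV[R]_n}) D, [set` S] = Tan A a ->
         is_ptD2 A a S D ->
         forall v, Tan A a v -> dot (D v v) nu <= r^-1 * enorm v ^+ 2) &
      (ap_differentiable 2 A a ->
         forall (T : {vspace 'rV[R]_n}) D, is_apTan A a T -> is_apD2 A a D ->
         forall v, v \in T -> dot (D v v) nu <= r^-1 * enorm v ^+ 2)].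
Proof.
have Asup := supported_ball hnu hr hA.
split=> [m Amfd Aa b Hb|_ S D SE HD|_ T D HT HD].
- exact: submanifold_second_order hr hnu Asup Amfd Aa Hb.
- exact: pointwise_second_order hr hnu Asup SE HD.
- exact: approximate_second_order hr hnu Asup HT HD.
Qed.
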